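(* Let $\Delta$ be a countable distance value set with $\inf\Delta=0$, and let $H$ be a countable omnigenous locally finite group. Then there is a group embedding $\pi\colon H\to\mathrm{Iso}(\mathbb{U}_\Delta)$ with dense image such that $H$, equipped with the weakest topology making $\pi$ continuous, has the strong Lévy property.
   Context: All topological spaces are assumed Hausdorff. A topological group $G$ has the strong Lévy property if there is an increasing sequence $(K_i)_{i\in\mathbb{N}}$ of finite subgroups of $G$, with normalized counting measures $\mu_i$ on $K_i$ (regarded as measures on $G$), such that (i) $\bigcup_i K_i$ is dense in $G$, and (ii) for each open neighborhood $V$ of the identity of $G$ and each sequence of sets $A_i\subseteq K_i$ with $\liminf_i\mu_i(A_i)>0$, one has $\lim_i\mu_i(VA_i)=1$. A distance value set is a nonempty set $\Delta$ of positive real numbers such that $\min\{x+y,\sup\Delta\}\in\Delta$ for all $x,y\in\Delta$ (where $\sup\Delta$ may be $+\infty$). A $\Delta$-metric space is a metric space whose nonzero distances all belong to $\Delta$. For countable $\Delta$, $\mathbb{U}_\Delta$ is the unique, up to isometry, countable $\Delta$-metric space that contains an isometric copy of every finite $\Delta$-metric space and is ultrahomogeneous (every isometry between finite subspaces extends to an isometry of $\mathbb{U}_\Delta$ onto itself). $\mathrm{Iso}(\mathbb{U}_\Delta)$ is the group of all isometries of $\mathbb{U}_\Delta$ onto itself, with the topology of pointwise convergence where $\mathbb{U}_\Delta$ carries its metric topology: basic open neighborhoods of the identity are $\{g : d_{\mathbb{U}_\Delta}(x_i,g(x_i))<\epsilon,\ i=1,\dots,n\}$ for $x_1,\dots,x_n\in\mathbb{U}_\Delta$,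 $\epsilon>0$. A group is locally finite if every finitely generated subgroup is finite. A group $G$ is omnigenous if for every finite subgroup $G_1\le G$, all finite groups $\Gamma_1\le\Gamma_2$ and every group isomorphism $\Psi_1\colon G_1\cong\Gamma_1$, there are a finite subgroup $G_2\le G$ with $G_1\le G_2$ and an onto homomorphism $\Psi_2\colon G_2\to\Gamma_2$ such that $\Psi_2\restriction G_1=\Psi_1$. *)

(* Defs.v *)
From HB Require Import structures.
From mathcomp Require Import all_boot all_order all_algebra all_fingroup.
From mathcomp Require Import finmap.
From mathcomp Require Import all_classical all_reals all_analysis.

Set Implicit Arguments.
Unset Strict Implicit.
Unset Printing Implicit Defensive.

Import Order.TTheory GRing.Theory Num.Theory.
Import numFieldNormedType.Exports.

Local Open Scope classical_set_scope.
Local Open Scope ring_scope.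

Section Groups.
Local Open Scope group_scope.

Definition subgroup (G : groupType) (K : set G) : Prop := group_closed (mem K).

Definition finite_subgroup (G : groupType) (K : set G) : Prop :=
  subgroup K /\ finite_set K.

Definition locally_finite (G : groupType) : Prop :=
  forall S : set G, finite_set S -> finite_set (smallest (@subgroup G) S).

(* Homomorphisms defined on a finite subgroup of G are represented by functions
   on G of which only the values on that subgroup are constrained. *)
Definition omnigenous (G : groupType) : Prop :=
  forall (G1 : set G) (gT : finGroupType) (Gamma1 Gamma2 : {group gT})
         (Psi1 : G -> gT),
    finite_subgroup G1 ->
    Gamma1 \subset Gamma2 ->
    {in G1 &, {morph Psi1 : x y / x * y}} ->
    set_bij G1 [set` Gamma1] Psi1 ->
  exists (G2 : set G) (Psi2 : G -> gT),
    [/\ finite_subgroup G2,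
        G1 `<=` G2,
        {in G2 &, {morph Psi2 : x y / x * y}},
        Psi2 @` G2 = [set` Gamma2] &
        {in G1, Psi2 =1 Psi1}].

End Groups.

#[short(type="preTopologicalGroupType")]
HB.structure Definition PreTopologicalGroup := {G of Topological G & monoid.Group G}.

Definition topological_group (G : preTopologicalGroupType) : Prop :=
  [/\ hausdorff_space G,
      continuous (fun p : G * G => (p.1 * p.2)%g) &
      continuous (fun x : G => (x^-1)%g)].

(* The measure of A for the normalized counting measure on the finite nonempty
   set K, regarded as a measure on the ambient type. *)
Definition normalized_counting (R : realType) (T : choiceType) (K A : set T) : R :=
  #|` fset_set (A `&` K)|%:R / #|` fset_set K|%:R.

(* R only provides the values of the measures. *)
Definition strong_levy (R : realType) (G : preTopologicalGroupType) : Prop :=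
  topological_group G /\
  exists K : nat -> set G,
    [/\ forall i, finite_subgroup (K i),
        forall i j, (i <= j)%N -> K i `<=` K j,
        dense (\bigcup_i K i) &
        forall (V : set G) (A : nat -> set G),
          open V -> V 1%g ->
          (forall i, A i `<=` K i) ->
          0 < limn_inf (fun i => normalized_counting R (K i) (A i)) ->
          (fun i => normalized_counting R (K i)
                      [set (v * a)%g | v in V & a in A i]) @ \oo --> (1 : R)].

HB.instance Definition _ (G : groupType) (T : Type) (f : G -> T) :=
  monoid.Group.copy (initial_topology f) G.

HB.instance Definition _ (G : groupType) (T : topologicalType) (f : G -> T) :=
  monoid.Group.on (initial_topology f).

Section Metric.
Context {R : realType}.

Definition distance_value_set (Delta : set R) : Prop :=
  [/\ Delta !=set0,
      forall x, Delta x -> 0 < x &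
      forall x y, Delta x -> Delta y ->
        exists2 z, Delta z &
          z%:E = mine (x + y)%:E (ereal_sup [set w%:E | w in Delta])].

Definition delta_metric (Delta : set R) (T : metricType R) : Prop :=
  forall x y : T, mdist x y != 0 -> Delta (mdist x y).

Definition isometric (S T : metricType R) (f : S -> T) : Prop :=
  forall x y, mdist (f x) (f y) = mdist x y.

(* Isometries of T onto itself; injectivity is automatic (iso_inj). *)
Record iso (T : metricType R) := Iso {
  iso_fun :> T -> T ;
  iso_isometric : isometric iso_fun ;
  iso_surj : forall y, exists x, iso_fun x = y }.

Definition delta_universal (Delta : set R) (U : metricType R) : Prop :=
  forall F : metricType R, finite_set [set: F] -> delta_metric Delta F ->
    exists f : F -> U, isometric f.

Definition ultrahomogeneous (U : metricType R) : Prop :=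
  forall (A : set U) (f : U -> U), finite_set A ->
    {in A &, forall x y, mdist (f x) (f y) = mdist x y} ->
    exists g : iso U, {in A, g =1 f}.

(* By back-and-forth any two spaces with these properties are isometric, so a
   statement about U_Delta is stated for all of them. *)
Definition delta_urysohn (Delta : set R) (U : metricType R) : Prop :=
  [/\ countable [set: U],
      delta_metric Delta U,
      delta_universal Delta U &
      ultrahomogeneous U].

End Metric.

Section IsoGroup.
Context {R : realType} (T : metricType R).
Implicit Types f g h : iso T.

Lemma iso_ext f g : f =1 g -> f = g.
Proof.
case: f g => [f fi fs] [g gi gs] /= /funext fg; subst g.
by congr Iso; exact: Prop_irrelevance.
Qed.

Lemma iso_inj f : injective f.
Proof.
move=> x y fxy; apply: mdist_positivity.
by rewrite -(iso_isometric f) fxy mdistxx.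
Qed.

Fact iso_one_surj (y : T) : exists x, id x = y. Proof. by exists y. Qed.

Definition iso_one : iso T := @Iso _ _ id (fun _ _ => erefl) iso_one_surj.

Fact iso_mul_isometric f g : isometric (f \o g).
Proof. by move=> x y /=; rewrite !iso_isometric. Qed.

Fact iso_mul_surj f g y : exists x, (f \o g) x = y.
Proof.
have [z <-] := iso_surj f y; have [x <-] := iso_surj g z.
by exists x.
Qed.

Definition iso_mul f g : iso T :=
  Iso (iso_mul_isometric f g) (iso_mul_surj f g).

Definition iso_inv_fun f (y : T) : T := sval (cid (iso_surj f y)).

Lemma iso_inv_funK f y : f (iso_inv_fun f y) = y.
Proof. by rewrite /iso_inv_fun; case: cid. Qed.

Fact iso_inv_isometric f : isometric (iso_inv_fun f).
Proof. by move=> x y; rewrite -(iso_isometric f) !iso_inv_funK. Qed.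

Fact iso_inv_surj f y : exists x, iso_inv_fun f x = y.
Proof. by exists (f y); apply: (@iso_inj f); rewrite iso_inv_funK. Qed.

Definition iso_inv f : iso T := Iso (iso_inv_isometric f) (iso_inv_surj f).

Lemma iso_mulA : associative iso_mul.
Proof. by move=> f g h; exact: iso_ext. Qed.

Lemma iso_mul1 : left_id iso_one iso_mul.
Proof. by move=> f; exact: iso_ext. Qed.

Lemma iso_mulr1 : right_id iso_one iso_mul.
Proof. by move=> f; exact: iso_ext. Qed.

Lemma iso_mulV : left_inverse iso_one iso_inv iso_mul.
Proof.
move=> f; apply: iso_ext => x; apply: (@iso_inj f).
by rewrite /= iso_inv_funK.
Qed.

Lemma iso_mulrV : right_inverse iso_one iso_inv iso_mul.
Proof. by move=> f; apply: iso_ext => x; rewrite /= iso_inv_funK. Qed.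

HB.instance Definition _ := gen_eqMixin (iso T).
HB.instance Definition _ := gen_choiceMixin (iso T).
HB.instance Definition _ := isGroup.Build (iso T)
  iso_mulA iso_mul1 iso_mulr1 iso_mulV iso_mulrV.

Definition iso_ptws (f : iso T) : {ptws T -> T} := iso_fun f.

(* Pointwise convergence, T carrying its metric topology. *)
HB.instance Definition _ :=
  Topological.copy (iso T) (initial_topology iso_ptws).

End IsoGroup.

(* Main.v *)
Require Import Defs.
From HB Require Import structures.
From mathcomp Require Import all_boot all_order all_algebra all_fingroup.
From mathcomp Require Import finmap.
From mathcomp Require Import all_classical all_reals all_analysis.
From mathcomp Require Import lra ring.

Set Implicit Arguments.
Unset Strict Implicit.
Unset Printing Implicit Defensive.

Import Order.TTheory GRing.Theory Num.Theory.
Import numFieldNormedType.Exports.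

Local Open Scope classical_set_scope.
Local Open Scope ring_scope.

(** The embedding is the limit of a chain of finite approximations ([stage]): a
    finite subgroup of [H] acting by isometries on a finite set of points of
    [U]. When the subgroups exhaust [H] and the sets exhaust [U], the actions
    fit together to an action of [H] on [U], that is, a homomorphism to the
    isometry group ([limit_iso]). Each step of the chain ([next_stage]) serves
    one more element of [H], some points of [U], one partial isometry to be
    approximated, for density, and concentration of measure.

    Enlarging a stage is reduced to finite combinatorics by [realize]: it is
    enough to give a finite group, extending the one of the stage, that acts on
    a finite real-valued pseudometric space containing the points of the stage.
    Since [Delta] has arbitrarily small elements, real distances can be rounded
    up into [Delta] without losing the triangle inequality or changing the
    distances already fixed ([rounding]); universality and ultrahomogeneity
    then place the space in [U], and omnigenicity ([omnigenous_hom]) finds the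
    finite group, up to a quotient, inside [H].

    Density ([step_match]) asks that a partial isometry be approximated by a
    group element. After doubling the space the partial isometry becomes a
    partial involution. Gluing translates of the space along a free product of
    the group with an involution [t], with a cost [eps] for each use of [t],
    gives an infinite space where [t] realizes the involution up to [eps]. As
    distances are bounded, only words of bounded length matter, so the free
    product can be replaced by a finite group of permutations of such words
    ([approximate_extension]).

    Concentration ([step_concentrate]) replaces the group by a large power of
    itself acting coordinatewise on a power of the space with the averaged
    distance, the old stage being embedded diagonally. Two sets of positive
    measure in a power cannot be far apart for the Hamming distance, by a
    variance estimate ([concentration]), and elements close for the Hamming
    distance displace the diagonal almost equally. Applied at each step with
    tolerances tending to zero, this is the strong Levy property along the
    chain of subgroups ([concentrated_levy]). *)

(** * Rounding distances into the value set *)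

Section Rounding.
Context {R : realType}.
Implicit Types (D r c : R) (qs : seq R).

(** The least sum of at most [n] elements of [qs] that reaches [r], capped at [D]. *)
Fixpoint cover D qs n r : R :=
  if r <= 0 then 0 else
  if n is n'.+1 then \big[Num.min/D]_(q <- qs) (q + cover D qs n' (r - q))
  else D.

Lemma cover_le0 D qs n r : r <= 0 -> cover D qs n r = 0.
Proof. by case: n => [|n] /= ->. Qed.

Lemma cover_gt0 D qs n r : 0 < r ->
  cover D qs n.+1 r = \big[Num.min/D]_(q <- qs) (q + cover D qs n (r - q)).
Proof. by move=> r0; rewrite /= leNgt r0. Qed.

Lemma cover0_gt0 D qs r : 0 < r -> cover D qs 0 r = D.
Proof. by move=> r0; rewrite /= leNgt r0. Qed.

Lemma bigmin_attained (I : eqType) (s : seq I) (x : R) (F : I -> R) :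
  \big[Num.min/x]_(i <- s) F i = x \/
  exists2 i, i \in s & \big[Num.min/x]_(i <- s) F i = F i.
Proof.
elim: s => [|i s IH]; first by left; rewrite big_nil.
rewrite big_cons minEle; case: ifPn => _.
  by right; exists i => //; rewrite mem_head.
case: IH => [->|[j js ->]]; first by left.
by right; exists j => //; rewrite inE js orbT.
Qed.

Section Cover.
Variables (D c : R) (qs : seq R).
Hypotheses (c_gt0 : 0 < c) (c_le_qs : forall q, q \in qs -> c <= q).
Hypotheses (qs_le_D : forall q, q \in qs -> q <= D) (c_le_D : c <= D).

Let D_ge0 : 0 <= D. Proof. exact: le_trans (ltW c_gt0) c_le_D. Qed.

Let psi := cover D qs.

Let psi_step n r q : 0 < r -> q \in qs -> psi n.+1 r <= q + psi n (r - q).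
Proof. by move=> r0 qqs; rewrite /psi cover_gt0 //; exact: ge_bigmin_seq. Qed.

Let psi_cases n r : 0 < r -> psi n.+1 r = D \/
  exists2 q, q \in qs & psi n.+1 r = q + psi n (r - q).
Proof. by move=> r0; rewrite /psi cover_gt0 //; exact: bigmin_attained. Qed.

Lemma cover_leD n r : psi n r <= D.
Proof.
rewrite /psi; case: n => [|n] /=; case: ifP => // _.
exact: bigmin_le_id.
Qed.

Lemma cover_ge_min n r : Num.min r D <= psi n r.
Proof.
elim: n r => [|n IH] r.
  have [r0|r0] := leP r 0; first by rewrite /psi cover_le0 // ge_min r0.
  by rewrite /psi cover0_gt0 // ge_min lexx orbT.
have [r0|r0] := leP r 0; first by rewrite /psi cover_le0 // ge_min r0.
case: (psi_cases n r0) => [->|[q qqs ->]]; first by rewrite ge_min lexx orbT.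
have := IH (r - q); have := c_le_qs qqs.
rewrite !ge_min => cq /orP[] h; apply/orP; [left; lra|right].
by have := c_gt0; lra.
Qed.

Lemma cover_ge0 n r : 0 <= psi n r.
Proof.
have [r0|r0] := leP r 0; first by rewrite /psi cover_le0.
by apply: le_trans (cover_ge_min n r); rewrite le_min (ltW r0).
Qed.

Lemma cover_mono n : {homo psi n : r s / r <= s}.
Proof.
elim: n => [|n IH] r s rs; have [r0|r0] := leP r 0;
  try by rewrite {1}/psi cover_le0 // cover_ge0.
- by rewrite /psi !cover0_gt0 // (lt_le_trans r0 rs).
- case: (psi_cases n (lt_le_trans r0 rs)) => [->|[q qqs ->]].
    exact: cover_leD.
  by apply: le_trans (psi_step n r0 qqs) _; rewrite lerD2l IH // lerB.
Qed.

Lemma cover_succ_le n r : psi n.+1 r <= psi n r.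
Proof.
have [r0|r0] := leP r 0; first by rewrite /psi !cover_le0.
elim: n r r0 => [|n IH] r r0.
  by rewrite {2}/psi cover0_gt0 // cover_leD.
case: (psi_cases n r0) => [->|[q qqs ->]]; first exact: cover_leD.
apply: le_trans (psi_step _ r0 qqs) _; rewrite lerD2l.
have [rq0|] := leP (r - q) 0; last exact: IH.
by rewrite /psi !cover_le0.
Qed.

Lemma cover_anti m n r : (m <= n)%N -> psi n r <= psi m r.
Proof.
move=> /subnK <-; elim: (n - m)%N => [|k IH] //.
by apply: le_trans IH; rewrite addSn cover_succ_le.
Qed.

Lemma cover_subadd m n a b : psi (m + n) (a + b) <= psi m a + psi n b.
Proof.
elim: m a b => [|m IH] a b.
  have [a0|a0] := leP a 0.
    by rewrite {2}/psi cover_le0 // add0r add0n cover_mono //; lra.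
  apply: le_trans (cover_leD _ _) _; rewrite {1}/psi cover0_gt0 // lerDl.
  exact: cover_ge0.
have [a0|a0] := leP a 0.
  rewrite {2}/psi cover_le0 // add0r.
  apply: le_trans (cover_anti b (leq_addl m.+1 n)).
  by apply: cover_mono; lra.
have [ab0|ab0] := leP (a + b) 0.
  by rewrite {1}/psi cover_le0 // addr_ge0 // cover_ge0.
case: (psi_cases m a0) => [->|[q qqs ->]].
  by apply: le_trans (cover_leD _ _) _; rewrite lerDl cover_ge0.
apply: le_trans (psi_step _ ab0 qqs) _.
by rewrite -[leRHS]addrA lerD2l addrAC; exact: IH.
Qed.

(** Every generator is at least [c], so a value below [c *+ n.+1] is a sum of at
    most [n] generators. *)
Lemma cover_stable_small n r :
  psi n.+1 r < c *+ n.+1 -> psi n.+1 r = psi n r.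
Proof.
have [r0|r0] := leP r 0; first by rewrite /psi !cover_le0.
elim: n r r0 => [|n IH] r r0.
  case: (psi_cases 0 r0) => [->|[q qqs ->]]; first by rewrite ltNge mulr1n c_le_D.
  have := c_le_qs qqs; have := cover_ge0 0 (r - q); rewrite mulr1n; lra.
case: (psi_cases n.+1 r0) => [E _|[q qqs E]].
  by apply/eqP; rewrite eq_le cover_succ_le E cover_leD.
rewrite E mulrS => lt; apply/eqP; rewrite -E eq_le cover_succ_le /= E.
have -> : psi n.+1 (r - q) = psi n (r - q).
  have [rq0|rq0] := leP (r - q) 0; first by rewrite /psi !cover_le0.
  by apply: IH => //; have := c_le_qs qqs; lra.
exact: psi_step.
Qed.

(** A sum of [N] terms already reaches the cap, so the recursion is stationary; this
    turns [cover_subadd], which adds the numbers of terms, into subadditivity of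
    one function. *)
Lemma cover_stable N n r : D <= c *+ N -> (N <= n)%N -> psi n r = psi N r.
Proof.
move=> DN /subnK <-; elim: (n - N)%N => [|k IH] //; rewrite addSn -{}IH.
have [lt|ge] := ltP (psi (k + N).+1 r) (c *+ (k + N).+1).
  exact: cover_stable_small.
apply/eqP; rewrite eq_le cover_succ_le; apply: le_trans (cover_leD _ _) _.
apply: le_trans ge; apply: le_trans DN _; rewrite -addSn addnC.
by rewrite mulrnDr lerDl mulrn_wge0 // ltW.
Qed.

Lemma cover_le_add n q r : q \in qs -> - q <= r -> r <= q *+ n ->
  psi n r <= r + q.
Proof.
move=> qqs; elim: n r => [|n IH] r qr rn.
  by rewrite /psi cover_le0 //; lra.
have [r0|r0] := leP r 0; first by rewrite /psi cover_le0 //; lra.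
apply: le_trans (psi_step n r0 qqs) _.
suff : psi n (r - q) <= r - q + q by lra.
by apply: IH; [lra|move: rn; rewrite mulrS; lra].
Qed.

Lemma cover_gen n q : q \in qs -> psi n.+1 q = q.
Proof.
move=> qqs; have q0 : 0 < q by apply: lt_le_trans (c_le_qs qqs).
apply/eqP; rewrite eq_le; apply/andP; split.
  by apply: le_trans (psi_step n q0 qqs) _; rewrite subrr /psi cover_le0 // addr0.
by apply: le_trans (cover_ge_min _ _); rewrite le_min lexx qs_le_D.
Qed.

Lemma cover_in (P : R -> Prop) n r : P D -> (forall q, q \in qs -> P q) ->
  (forall x y, P x -> P y -> x + y < D -> P (x + y)) ->
  0 < r -> P (psi n r).
Proof.
move=> PD Pq Padd; elim: n r => [|n IH] r r0.
  by rewrite /psi cover0_gt0.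
case: (psi_cases n r0) => [->//|[q qqs E]].
have [rq0|rq0] := leP (r - q) 0.
  by rewrite E /psi cover_le0 // addr0; exact: Pq.
have := cover_leD n.+1 r; rewrite le_eqVlt => /predU1P[->//|].
by rewrite E => lt; apply: Padd => //; [exact: Pq|exact: IH].
Qed.

End Cover.

(** Replacing a pseudometric by its image under [phi] keeps the triangle
    inequality (monotone and subadditive), puts its nonzero values in [Delta],
    changes them by an arbitrarily small amount upwards, and leaves prescribed
    values of [Delta] alone. It is the only place where the arithmetic of [Delta]
    enters: afterwards pseudometrics may take arbitrary real values. Take for
    [phi r] the least element at least [r] of the truncated semigroup generated by
    the prescribed values and one element of [Delta] below [delta]. *)
Lemma rounding (Delta : set R) (ds : seq R) (delta : R) :
  distance_value_set Delta -> inf Delta = 0 ->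
  (forall d, d \in ds -> Delta d) -> 0 < delta ->
  exists phi : R -> R,
    [/\ phi 0 = 0, forall r, 0 < r -> Delta (phi r),
       {homo phi : r s / r <= s},
       forall a b, phi (a + b) <= phi a + phi b &
       (forall d, d \in ds -> phi d = d) /\
       (forall r, 0 <= r -> phi r <= r + delta)].
Proof.
move=> [Delta0 Dpos Dadd] infD dsD delta0.
have [c0 Dc0 c0d] : exists2 c0, Delta c0 & c0 < delta.
  have hi : has_inf Delta by split => //; exists 0 => x /Dpos /ltW.
  by have [x Dx] := inf_adherent delta0 hi; rewrite infD add0r; exists x.
pose qs := c0 :: ds.
have qsD q : q \in qs -> Delta q by rewrite inE => /predU1P[->//|/dsD].
pose D := \big[Num.max/c0]_(q <- qs) q.
pose c := \big[Num.min/c0]_(q <- qs) q.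
have qs_le_D q : q \in qs -> q <= D by move=> ?; exact: le_bigmax_seq.
have c_le_qs q : q \in qs -> c <= q by move=> ?; exact: ge_bigmin_seq.
have DD : Delta D.
  rewrite /D big_seq; apply: big_ind => // x y Dx Dy.
  by rewrite maxEle; case: ifP.
have c0qs : c0 \in qs by rewrite mem_head.
have cpos : 0 < c.
  rewrite /c big_seq; apply: (big_ind (fun x => 0 < x)) => //.
  - exact: Dpos.
  - by move=> x y x0 y0; rewrite minEle; case: ifP.
  - by move=> q /qsD /Dpos.
have cD : c <= D by apply: le_trans (c_le_qs _ c0qs) (qs_le_D _ c0qs).
have [N DN] : exists N, D <= c *+ N.
  exists (Num.bound (D / c)); rewrite -mulr_natl -ler_pdivrMr //.
  by apply/ltW/archi_boundP/divr_ge0; apply/ltW => //; exact: Dpos.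
exists (cover D qs N.+1); split.
- by rewrite cover_le0.
- move=> r r0; apply: (@cover_in D c qs cpos cD Delta) => // x y Dx Dy xyD.
  have [z Dz] := Dadd x y Dx Dy; rewrite /mine.
  case: ifPn => [_ [<-]//|]; rewrite -leNgt => le.
  have : (D%:E <= ereal_sup [set w%:E | w in Delta])%E.
    by apply: ereal_sup_ubound; exists D.
  by move=> /le_trans /(_ le); rewrite lee_fin leNgt xyD.
- exact: (@cover_mono D c).
- move=> a b; rewrite -(@cover_stable D c qs _ _ _ N.+1 (N.+1 + N.+1)) //.
  + exact: (@cover_subadd D c).
  + by apply: le_trans DN _; rewrite mulrSr lerDl ltW.
  + exact: leq_addr.
- split; first by move=> d dds; apply: (@cover_gen D c) => //; rewrite inE dds orbT.
  move=> r r0; have [le|gt] := leP r (c0 *+ N.+1).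
    apply: le_trans (_ : r + c0 <= _); last by rewrite lerD2l ltW.
    by apply: cover_le_add => //; have := Dpos _ Dc0; lra.
  apply: le_trans (cover_leD qs cpos cD N.+1 r) _.
  apply: le_trans (_ : c0 *+ N.+1 <= _); last by lra.
  apply: le_trans DN _; rewrite mulrSr.
  have := lerMn2r N c c0; rewrite (c_le_qs _ c0qs) orbT.
  by have := Dpos _ Dc0; lra.
Qed.
End Rounding.

(** * Realizing finite pseudometrics in the Urysohn space *)

Definition pseudometric {R : realType} (Z : Type) (rho : Z -> Z -> R) :=
  [/\ forall z, rho z z = 0, forall z z', rho z z' = rho z' z &
      forall z' z z'', rho z z'' <= rho z z' + rho z' z''].

Section Quotient.
Context {R : realType} {Z : finType} {rho : Z -> Z -> R}.
Hypothesis pm : pseudometric rho.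

Lemma pm_ge0 z z' : 0 <= rho z z'.
Proof.
have [h1 h2 h3] := pm; have := h3 z' z z.
by rewrite h1 (h2 z') -mulr2n pmulrn_lge0.
Qed.

Lemma pm_zero_class z z' : rho z z' = 0 -> rho z =1 rho z'.
Proof.
have [h1 h2 h3] := pm => zz' w.
have a := h3 z' z w; have b := h3 z z' w; rewrite (h2 z' z) zz' !add0r in a b.
by apply/eqP; rewrite eq_le a b.
Qed.

Definition class_repr z := odflt z [pick z' | rho z z' == 0].

Lemma class_reprP z : rho z (class_repr z) = 0.
Proof.
rewrite /class_repr; case: pickP => [z' /eqP //|/(_ z)].
by have [-> _ _] := pm; rewrite eqxx.
Qed.

Lemma class_repr_eq z z' : rho z z' = 0 -> class_repr z = class_repr z'.
Proof.
move=> zz'; rewrite /class_repr 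
  (eq_pick (fun w => congr1 (eq_op^~ 0) (pm_zero_class zz' w))).
case: pickP => // /(_ z'); have [h1 _ _] := pm; by rewrite h1 eqxx.
Qed.

Lemma class_repr_idem z : class_repr (class_repr z) == class_repr z.
Proof. by apply/eqP/esym/class_repr_eq/class_reprP. Qed.

(** The proof is an argument of the type so that the metric structure can be
    attached to it. *)
Definition mquot of pseudometric rho := {z : Z | class_repr z == z}.

Definition mquot_pi z : mquot pm := exist _ (class_repr z) (class_repr_idem z).

HB.instance Definition _ := Choice.on (mquot pm).

Let dist (x y : mquot pm) := rho (sval x) (sval y).

Let dist0 x : dist x x = 0. Proof. by have [h _ _] := pm; exact: h. Qed.

Let dist_pos x y : dist x y = 0 -> x = y.
Proof.
move=> /class_repr_eq E.
apply: (@val_inj _ _ {z : Z | class_repr z == z}) => /=.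
by rewrite -(eqP (svalP x)) -(eqP (svalP y)).
Qed.

Let dist_sym x y : dist x y = dist y x. Proof. by have [_ h _] := pm; exact: h. Qed.

Let dist_tri y x z : dist x z <= dist x y + dist y z.
Proof. by have [_ _ h] := pm; exact: h. Qed.

HB.instance Definition _ :=
  isMetric.Build R (mquot pm) dist0 dist_pos dist_sym dist_tri.

Lemma mquot_dist z z' : mdist (mquot_pi z) (mquot_pi z') = rho z z'.
Proof.
have -> : mdist (mquot_pi z) (mquot_pi z') = rho (class_repr z) (class_repr z').
  by [].
have [_ h2 _] := pm.
rewrite -(pm_zero_class (class_reprP z)) h2 -(pm_zero_class (class_reprP z')).
exact: h2.
Qed.

Lemma mquot_finite : finite_set [set: mquot pm].
Proof. exact: (@finite_finset {z : Z | class_repr z == z}). Qed.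

End Quotient.

Section Extension.
Context {R : realType} {Delta : set R} {U : metricType R}.
Hypothesis U_Delta : delta_urysohn Delta U.

(** Universality gives some copy of the metric quotient of [Z]; ultrahomogeneity
    moves it so that it extends the given copy of [X]. *)
Lemma urysohn_extension (Z : finType) (rho : Z -> Z -> R) (X : set U)
    (j : U -> Z) :
  pseudometric rho -> (forall z z', rho z z' != 0 -> Delta (rho z z')) ->
  finite_set X -> (forall x y, X x -> X y -> rho (j x) (j y) = mdist x y) ->
  exists e : Z -> U, (forall z z', mdist (e z) (e z') = rho z z') /\
    forall x, X x -> e (j x) = x.
Proof.
move=> pm rhoD finX jiso; have [_ _ univ homog] := U_Delta.
have [|f fiso] := univ (mquot pm) (mquot_finite pm); first by move=> x y /rhoD.
pose f' z := f (mquot_pi pm z).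
have f'iso z z' : mdist (f' z) (f' z') = rho z z' by rewrite fiso mquot_dist.
pose A := [set f' (j x) | x in X].
have inv y : exists x, A y -> X x /\ f' (j x) = y.
  have [[x Xx <-]|nA] := pselect (A y); first by exists x.
  by exists y => /nA.
have [h hP] := choice inv.
have [||g gh] := homog A h; first exact: finite_image.
  move=> x y /set_mem /hP [Xx fx] /set_mem /hP [Xy fy].
  by rewrite -jiso // -f'iso fx fy.
exists (fun z => g (f' z)); split; first by move=> z z'; rewrite iso_isometric.
move=> x Xx; have Ax : A (f' (j x)) by exists x.
rewrite gh ?inE //; have [Xh fh] := hP _ Ax.
by apply: mdist_positivity; rewrite -jiso // -f'iso fh mdistxx.
Qed.

(** The second clause records that the embedding rounds equal distances equally,
    so that symmetries of [rho] remain symmetries in [U]. *)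
Lemma real_extension (Z : finType) (rho : Z -> Z -> R) (X : set U)
    (j : U -> Z) (delta : R) :
  distance_value_set Delta -> inf Delta = 0 -> 0 < delta ->
  pseudometric rho ->
  finite_set X -> (forall x y, X x -> X y -> rho (j x) (j y) = mdist x y) ->
  exists e : Z -> U, [/\ forall z z', mdist (e z) (e z') <= rho z z' + delta,
    forall z1 z1' z2 z2', rho z1 z1' = rho z2 z2' ->
      mdist (e z1) (e z1') = mdist (e z2) (e z2'),
    forall z z', e z = e z' <-> rho z z' = 0 &
    forall x, X x -> e (j x) = x].
Proof.
move=> dvs infD delta0 pm finX jiso; have [_ UD _ _] := U_Delta.
pose ds := [seq d <- [seq mdist p.1 p.2 | p <- fset_set (X `*` X)] | d != 0].
have dsD d : d \in ds -> Delta d.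
  rewrite mem_filter => /andP[d0 /mapP[p _ dE]].
  by rewrite dE; apply: UD; rewrite -dE.
have [phi [phi0 phiD phim phiadd [phids phile]]] := rounding dvs infD dsD delta0.
have rho0 := pm_ge0 pm; have [h1 h2 h3] := pm.
have phi_eq0 z z' : phi (rho z z') = 0 -> rho z z' = 0.
  have := rho0 z z'; rewrite le_eqVlt => /predU1P[<-//|/phiD D0 E].
  by move: D0; rewrite E => D0; have [_ /(_ _ D0)] := dvs; rewrite ltxx.
have [||||e [eiso ej]] := @urysohn_extension Z (fun z z' => phi (rho z z')) X j.
- split=> [z|z z'|z' z z'']; first by rewrite h1 phi0.
    by rewrite h2.
  by apply: le_trans (phiadd _ _); exact: phim.
- move=> z z'; have := rho0 z z'; rewrite le_eqVlt => /predU1P[<-|/phiD//].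
  by rewrite phi0 eqxx.
- by [].
- move=> x y Xx Xy; rewrite jiso //.
  have [->|d0] := eqVneq (mdist x y) 0; first by rewrite phi0.
  apply: phids; rewrite mem_filter d0 /=; apply/mapP; exists (x, y) => //.
  by rewrite in_fset_set ?inE //; exact: finite_setX.
exists e; split=> //.
- by move=> z z'; rewrite eiso phile.
- by move=> z1 z1' z2 z2' E; rewrite !eiso E.
- move=> z z'; split=> [E|E]; last by apply: mdist_positivity; rewrite eiso E.
  by apply: phi_eq0; rewrite -eiso E mdistxx.
Qed.

End Extension.

(** * Finite partial actions *)

Lemma mulg_idem (G : groupType) (x : G) : (x * x)%g = x -> x = 1%g.
Proof.
move=> /(congr1 (fun y => y * x^-1)%g).
by rewrite -mulgA mulgV mulg1.
Qed.

Section FiniteSubgroupType.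
Context {H : groupType} {K : set H}.
Hypothesis hK : finite_subgroup K.
Local Open Scope group_scope.

Lemma fsg1 : K 1.
Proof. by have [[/set_mem]] := hK. Qed.

Lemma fsgM x y : K x -> K y -> K (x * y).
Proof.
move=> Kx Ky; have [/group_closedM cl _] := hK.
by apply/set_mem/cl; rewrite inE.
Qed.

Lemma fsgV x : K x -> K x^-1.
Proof.
move=> Kx; have [/group_closedV cl _] := hK.
by apply/set_mem/cl; rewrite inE.
Qed.

(** The proof is an argument of the type so that the group structure can be
    attached to it. *)
Definition fsg of finite_subgroup K : Type := fset_set K.

HB.instance Definition _ := Finite.on (fsg hK).

Lemma fsg_mem x : K x -> x \in fset_set K.
Proof. by move=> Kx; rewrite in_fset_set ?inE //; case: hK. Qed.

Definition fsg_val (x : fsg hK) : H := fsval x.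

Lemma fsg_valP x : K (fsg_val x).
Proof. by have := fsvalP x; rewrite in_fset_set ?inE //; case: hK. Qed.

Definition fsg_in (x : H) : fsg hK := insubd [` fsg_mem fsg1]%fset x.

Lemma fsg_inK x : K x -> fsg_val (fsg_in x) = x.
Proof. by move=> Kx; rewrite /fsg_val /fsg_in insubdK //; exact: fsg_mem. Qed.

Lemma fsg_val_inj : injective fsg_val. Proof. exact: val_inj. Qed.

Let mul x y := fsg_in (fsg_val x * fsg_val y).
Let inv x := fsg_in (fsg_val x)^-1.
Let one := fsg_in 1.

Let valM x y : fsg_val (mul x y) = fsg_val x * fsg_val y.
Proof. by rewrite fsg_inK //; apply: fsgM; exact: fsg_valP. Qed.

Let valV x : fsg_val (inv x) = (fsg_val x)^-1.
Proof. by rewrite fsg_inK //; apply: fsgV; exact: fsg_valP. Qed.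

Let val1 : fsg_val one = 1. Proof. by rewrite fsg_inK //; exact: fsg1. Qed.

Let mulA : associative mul.
Proof. by move=> x y z; apply: fsg_val_inj; rewrite !valM mulgA. Qed.

Let mul1 : left_id one mul.
Proof. by move=> x; apply: fsg_val_inj; rewrite !valM val1 mul1g. Qed.

Let mulV : left_inverse one inv mul.
Proof. by move=> x; apply: fsg_val_inj; rewrite !valM valV val1 mulVg. Qed.

HB.instance Definition _ := Finite_isGroup.Build (fsg hK) mulA mul1 mulV.

Lemma fsg_valM x y : fsg_val (x * y) = fsg_val x * fsg_val y.
Proof. exact: valM. Qed.

Lemma fsg_valV x : fsg_val x^-1 = (fsg_val x)^-1.
Proof. exact: valV. Qed.

Lemma fsg_val1 : fsg_val 1 = 1. Proof. exact: val1. Qed.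

Lemma fsg_inM x y : K x -> K y -> fsg_in (x * y) = fsg_in x * fsg_in y.
Proof.
by move=> Kx Ky; apply: fsg_val_inj; rewrite fsg_valM !fsg_inK //; exact: fsgM.
Qed.

End FiniteSubgroupType.

(** Omnigenicity extends isomorphisms only; pairing [iota] with the identity of [K]
    makes it injective, and the second coordinate is dropped at the end. *)
Lemma omnigenous_hom (H : groupType) (K : set H) (gT : finGroupType)
    (iota : H -> gT) :
  omnigenous H -> finite_subgroup K ->
  {in K &, {morph iota : x y / (x * y)%g}} ->
  exists (K' : set H) (Psi : H -> gT),
    [/\ finite_subgroup K', K `<=` K',
        {in K' &, {morph Psi : x y / (x * y)%g}},
        {in K, Psi =1 iota} & forall c, exists2 g, K' g & Psi g = c].
Proof.
move=> omni hK iotaM.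
pose Psi1 k : gT * fsg hK := (iota k, fsg_in hK k).
have Psi1M x y : K x -> K y -> Psi1 (x * y)%g = (Psi1 x * Psi1 y)%g.
  by move=> Kx Ky; rewrite /Psi1 iotaM ?inE // fsg_inM.
pose G1 := [set Psi1 (fsg_val k) | k : fsg hK]%SET.
have G1P x : reflect (exists2 k, K k & x = Psi1 k) (x \in G1).
  apply: (iffP imsetP) => [[k _ ->]|[k Kk ->]].
    by exists (fsg_val k) => //; exact: fsg_valP.
  by exists (fsg_in hK k) => //; rewrite fsg_inK.
have gG1 : group_set G1.
  apply/group_setP; split.
    apply/G1P; exists 1%g; first exact: fsg1.
    by apply/esym/mulg_idem; rewrite -Psi1M ?mulg1 //; exact: fsg1.
  move=> x y /G1P[k Kk ->] /G1P[l Kl ->].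
  by apply/G1P; exists (k * l)%g; [exact: fsgM|rewrite Psi1M].
have [|||G2 [Psi2 [fG2 sub Psi2M Psi2im Psi2E]]] :=
    omni K _ (Group gG1) [set: gT * fsg hK]%G Psi1 hK.
- exact: finset.subsetT.
- by move=> x y /set_mem Kx /set_mem Ky; exact: Psi1M.
- split.
  + by move=> x Kx /=; apply/G1P; exists x.
  + move=> x y /set_mem Kx /set_mem Ky [_ E].
    by rewrite -(fsg_inK hK Kx) E fsg_inK.
  + by move=> x /= /G1P[k Kk ->]; exists k.
exists G2, (fun g => (Psi2 g).1); split=> //.
- by move=> x y xG yG /=; rewrite Psi2M.
- by move=> x xK /=; rewrite Psi2E.
- move=> c; have : (Psi2 @` G2) (c, 1%g) by rewrite Psi2im /= inE.
  by move=> [g Gg E]; exists g => //; rewrite E.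
Qed.

Section Stages.
Context {R : realType} {Delta : set R} {U : metricType R} {H : groupType}.

(** A finite approximation of the action to be built: a finite subgroup acting on
    a finite set of points. Only the values of [sact] on [grp] and [pts] matter. *)
Record stage := Stage {
  grp : set H;
  pts : set U;
  sact : H -> U -> U;
  grp_fin : finite_subgroup grp;
  pts_fin : finite_set pts;
  pts_ex : pts !=set0;
  sact_pts : forall g x, grp g -> pts x -> pts (sact g x);
  sact1 : forall x, pts x -> sact 1%g x = x;
  sactM : forall g h x, grp g -> grp h -> pts x ->
    sact (g * h)%g x = sact g (sact h x);
  sact_iso : forall g x y, grp g -> pts x -> pts y ->
    mdist (sact g x) (sact g y) = mdist x y }.

Definition extends (S S' : stage) :=
  [/\ grp S `<=` grp S', pts S `<=` pts S' &
      forall g x, grp S g -> pts S x -> sact S' g x = sact S g x].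

Lemma extends_refl S : extends S S. Proof. by split. Qed.

Lemma extends_trans S2 S1 S3 : extends S1 S2 -> extends S2 S3 -> extends S1 S3.
Proof.
move=> [g1 p1 a1] [g2 p2 a2]; split.
- exact: subset_trans g2.
- exact: subset_trans p2.
- by move=> g x gg xx; rewrite a2 ?a1 //; [exact: g1|exact: p1].
Qed.

Hypothesis U_Delta : delta_urysohn Delta U.
Hypothesis dvs : distance_value_set Delta.
Hypothesis infD : inf Delta = 0.

(** The workhorse of the construction. To enlarge a stage it is enough to describe
    the new points abstractly, as a finite set [Z] with an isometric action for
    some real-valued pseudometric that contains the old points isometrically and
    equivariantly. The larger set [F] allows points outside the stage to be
    prescribed as well. *)
Lemma realize (S : stage) (K' : set H) (gT : finGroupType) (Psi : H -> gT)
    (Z : finType) (a : gT -> Z -> Z) (rho : Z -> Z -> R)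
    (F : set U) (j : U -> Z) (delta : R) :
  0 < delta -> finite_subgroup K' -> grp S `<=` K' ->
  {in K' &, {morph Psi : x y / (x * y)%g}} ->
  (forall z, a 1%g z = z) -> (forall g h z, a (g * h)%g z = a g (a h z)) ->
  pseudometric rho -> (forall g z z', rho (a g z) (a g z') = rho z z') ->
  finite_set F -> pts S `<=` F ->
  (forall x y, F x -> F y -> rho (j x) (j y) = mdist x y) ->
  (forall g x, grp S g -> pts S x ->
     rho (a (Psi g) (j x)) (j (sact S g x)) = 0) ->
  exists (S' : stage) (e : Z -> U),
    [/\ extends S S', grp S' = K', F `<=` pts S', forall x, F x -> e (j x) = x &
    [/\ forall z z', mdist (e z) (e z') <= rho z z' + delta,
        forall z z', e z = e z' -> rho z z' = 0,
        forall z, pts S' (e z) &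
        forall g z, K' g -> sact S' g (e z) = e (a (Psi g) z)]].
Proof.
move=> delta0 fK' SK' PsiM a1 aM pm ainv finF SF jiso jequi.
have [e [ele eeq e0 ej]] :=
  real_extension U_Delta dvs infD delta0 pm finF jiso.
have Psi1 : Psi 1%g = 1%g.
  have K1 := fsg1 fK'.
  by apply: mulg_idem; rewrite -PsiM ?inE // mulg1.
pose inv_e u := xget (j u) [set z | e z = u].
have inv_eK z : rho (inv_e (e z)) z = 0.
  by apply/e0; rewrite /inv_e; case: xgetP => [z' _ //|/(_ z)]; case.
pose sact' g u := e (a (Psi g) (inv_e u)).
have sact'E g z : sact' g (e z) = e (a (Psi g) z).
  by apply/e0; rewrite ainv inv_eK.
have [x0 Sx0] := pts_ex S.
have rP g x : range e x -> range e (sact' g x) by move=> _; exists (a (Psi g) (inv_e x)).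
unshelve eexists (@Stage K' (range e) sact' fK' _ _ _ _ _ _), e.
- exact/finite_image/finite_finset.
- by exists (e (j x0)); exists (j x0).
- by move=> g x _ /rP.
- by move=> _ [z _ <-]; rewrite sact'E Psi1 a1.
- by move=> g h _ Kg Kh [z _ <-]; rewrite !sact'E PsiM ?inE // aM.
- by move=> g _ _ Kg [z _ <-] [z' _ <-]; rewrite !sact'E; exact: eeq.
split=> //=.
- split=> //= [x /SF Fx|g x Sg Sx]; first by exists (j x) => //; exact: ej.
  rewrite -{1}(ej x) ?sact'E; last exact: SF.
  rewrite -[RHS]ej; last by apply: SF; exact: sact_pts.
  by apply/e0; exact: jequi.
- by move=> x Fx; exists (j x) => //; exact: ej.
- by split=> // [z z' /e0//|z]; exists z.
Qed.

Section FiniteAction.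
Variable S : stage.

Definition ptsT : finType := fset_set (pts S).
Definition grpT : finGroupType := fsg (grp_fin S).

Lemma ptsT_mem x : pts S x -> x \in fset_set (pts S).
Proof. by move=> Sx; rewrite in_fset_set ?inE //; exact: pts_fin. Qed.

Lemma ptsT_P (x : ptsT) : pts S (val x).
Proof. by have := fsvalP x; rewrite in_fset_set ?inE //; exact: pts_fin. Qed.

Definition ptsT0 : ptsT := [` ptsT_mem (svalP (cid (pts_ex S)))]%fset.

Definition ptsT_in (x : U) : ptsT := insubd ptsT0 x.

Lemma ptsT_inK x : pts S x -> val (ptsT_in x) = x.
Proof. by move=> Sx; rewrite /ptsT_in insubdK //; exact: ptsT_mem. Qed.

Definition actT (g : grpT) (x : ptsT) : ptsT :=
  ptsT_in (sact S (fsg_val g) (val x)).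

Lemma actT_val g x : val (actT g x) = sact S (fsg_val g) (val x).
Proof.
by apply/ptsT_inK/sact_pts; [exact: fsg_valP|exact: ptsT_P].
Qed.

Lemma actT1 x : actT 1%g x = x.
Proof.
by apply: val_inj; rewrite actT_val fsg_val1 sact1 //; exact: ptsT_P.
Qed.

Lemma actTM g h x : actT (g * h)%g x = actT g (actT h x).
Proof.
apply: val_inj; rewrite !actT_val fsg_valM sactM //;
  by [exact: fsg_valP|exact: ptsT_P].
Qed.

Definition distT (x y : ptsT) : R := mdist (val x) (val y).

Lemma distT_pm : pseudometric distT.
Proof.
split=> [x|x y|y x z]; first exact: mdistxx.
  exact: metric_sym.
exact: metric_triangle.
Qed.

Lemma actT_iso g x y : distT (actT g x) (actT g y) = distT x y.
Proof.
by rewrite /distT !actT_val sact_iso //; [exact: fsg_valP|exact: ptsT_P..].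
Qed.

Lemma actT_in g x : grp S g -> pts S x ->
  actT (fsg_in (grp_fin S) g) (ptsT_in x) = ptsT_in (sact S g x).
Proof.
by move=> Sg Sx; apply: val_inj;
  rewrite actT_val fsg_inK // !ptsT_inK //; exact: sact_pts.
Qed.

End FiniteAction.

End Stages.

Section OmnigenousExtension.
Context {R : realType} {Delta : set R} {U : metricType R} {H : groupType}.
Hypothesis U_Delta : delta_urysohn Delta U.
Hypothesis dvs : distance_value_set Delta.
Hypothesis infD : inf Delta = 0.
Implicit Types S : stage (U := U) (H := H).

Hypothesis omni : omnigenous H.

(** The case of [realize] where the new points are the translates of the old ones
    under a finite group receiving [grp S]; omnigenicity provides the group of the
    new stage, which covers that finite group. *)
Lemma omnigenous_extension S (gT : finGroupType) (iota : grpT S -> gT)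
    (rho : gT * ptsT S -> gT * ptsT S -> R) (delta : R) :
  0 < delta -> {morph iota : x y / (x * y)%g} -> pseudometric rho ->
  (forall g z z', rho ((g * z.1)%g, z.2) ((g * z'.1)%g, z'.2) = rho z z') ->
  (forall x y, rho (1%g, x) (1%g, y) = distT x y) ->
  (forall k x, rho (iota k, x) (1%g, actT k x) = 0) ->
  exists (S' : stage (U := U) (H := H)) (Psi : H -> gT),
    [/\ extends S S', {in grp S' &, {morph Psi : x y / (x * y)%g}},
        forall c, exists2 g, grp S' g & Psi g = c &
        forall g x y, grp S' g -> pts S x -> pts S y ->
          mdist (sact S' g x) y <=
            rho (Psi g, ptsT_in S x) (1%g, ptsT_in S y) + delta].
Proof.
move=> delta0 iotaM pm rho_inv rho1 rho_equi; pose fS := grp_fin S.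
have [|K' [Psi [fK' SK' PsiM PsiE Psi_onto]]] :=
  @omnigenous_hom H (grp S) gT (fun g => iota (fsg_in fS g)) omni fS.
  by move=> x y /set_mem Sx /set_mem Sy; rewrite fsg_inM.
pose a (g : gT) (z : gT * ptsT S) := ((g * z.1)%g, z.2).
pose j x : gT * ptsT S := (1%g, ptsT_in S x).
have [||||||||S' [e [ext gS' _ ej [ele _ _ eact]]]] :=
  @realize R Delta U H U_Delta dvs infD S K' gT Psi _ a rho (pts S) j delta
    delta0 fK' SK' PsiM.
- by move=> [m y]; rewrite /a mul1g.
- by move=> g k [m y]; rewrite /a mulgA.
- exact: pm.
- by move=> g z z'; exact: rho_inv.
- exact: pts_fin.
- by [].
- by move=> x y Sx Sy; rewrite rho1 /distT !ptsT_inK.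
- by move=> g x Sg Sx; rewrite /a /j /= mulg1 PsiE ?inE // -actT_in.
exists S', Psi; rewrite gS'; split=> // g x y Kg Sx Sy.
rewrite -[in leLHS](ej x Sx) -[in leLHS](ej y Sy) eact //.
by rewrite (le_trans (ele _ _)) // /a /= mulg1.
Qed.

End OmnigenousExtension.

(** * Adding group elements and points *)

Section SupDistance.
Context {R : realType} {Z : Type} {I : finType}.
Implicit Types (f : Z -> I -> R) (z : Z).

(** The pseudometric pulled back along a map into a finite dimensional sup-normed
    space, given by its coordinates. All properties of a pseudometric are then
    automatic, and permutations of the coordinates act by isometries. *)
Definition supdist f z z' : R := \big[Num.max/0]_i `|f z i - f z' i|.

Lemma supdist_ge f z z' i : `|f z i - f z' i| <= supdist f z z'.
Proof. exact: le_bigmax. Qed.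

Lemma supdist_le f z z' c : 0 <= c -> (forall i, `|f z i - f z' i| <= c) ->
  supdist f z z' <= c.
Proof. by move=> c0 h; apply: bigmax_le. Qed.

Lemma supdist_ge0 f z z' : 0 <= supdist f z z'.
Proof. exact: bigmax_ge_id. Qed.

Lemma supdist_eq0 f z z' : f z =1 f z' -> supdist f z z' = 0.
Proof.
move=> E; apply/eqP; rewrite eq_le supdist_ge0 andbT.
by apply: supdist_le => // i; rewrite E subrr normr0.
Qed.

Lemma supdist_pm f : pseudometric (supdist f).
Proof.
split=> [z|z z'|z' z z'']; first exact: supdist_eq0.
  by apply: eq_bigr => i _; rewrite distrC.
apply: supdist_le => [|i]; first by rewrite addr_ge0 // supdist_ge0.
apply: le_trans (ler_distD (f z' i) _ _) _.
by rewrite lerD // supdist_ge.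
Qed.

Lemma supdist_reindex f (g : Z -> Z) (s : I -> I) z z' :
  (forall z i, f (g z) i = f z (s i)) -> (forall i, exists i', s i' = i) ->
  supdist f (g z) (g z') = supdist f z z'.
Proof.
move=> fg sj; apply/eqP; rewrite eq_le; apply/andP; split.
  by apply: supdist_le => [|i]; rewrite ?supdist_ge0 // !fg supdist_ge.
apply: supdist_le => [|i]; rewrite ?supdist_ge0 //.
by have [i' <-] := sj i; rewrite -!fg supdist_ge.
Qed.

End SupDistance.

Lemma smallest_subgroup (H : groupType) (A : set H) :
  subgroup (smallest (@subgroup H) A).
Proof.
split; first by apply/mem_set => B [[/set_mem ? _] _].
move=> x y /set_mem xS /set_mem yS; apply/mem_set => B BA.
have [[_ cl] _] := BA; apply/set_mem/cl; apply/mem_set; [exact: xS|exact: yS].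
Qed.

Section AddElement.
Context {R : realType} {Delta : set R} {U : metricType R} {H : groupType}.
Hypothesis U_Delta : delta_urysohn Delta U.
Hypothesis dvs : distance_value_set Delta.
Hypothesis infD : inf Delta = 0.
Implicit Types S : stage (U := U) (H := H).

Lemma mdist_lip (x y z : U) : `|mdist x y - mdist x z| <= mdist y z.
Proof.
have := metric_triangle x y z; have := metric_triangle x z y.
by rewrite (metric_sym z y) => a b; rewrite ler_norml; apply/andP; split; lra.
Qed.

Lemma sact_invl S g x : grp S g -> pts S x -> sact S g^-1%g (sact S g x) = x.
Proof.
move=> Sg Sx; have fS := grp_fin S.
by rewrite -sactM ?mulVg ?sact1 //; exact: fsgV.
Qed.

Lemma sact_dist_inv S g x y : grp S g -> pts S x -> pts S y ->
  mdist (sact S g^-1%g x) y = mdist x (sact S g y).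
Proof.
move=> Sg Sx Sy; have fS := grp_fin S.
rewrite -{1}(sact_invl Sg Sy) sact_iso //; [exact: fsgV|exact: sact_pts].
Qed.

(** The new points are the pairs [(l, y)] with [l] in the group [L] generated by
    [grp S] and [h], and [y] either an old point, or [u], or one extra point. The
    coordinates with index [(v, x0)] imitate the embedding of a metric space into
    bounded functions, a point [y] being sent to its distances to the old points:
    when [v * l] is in [grp S] the coordinate is the distance from [x0] to the
    image of [y] under [v * l], and it vanishes otherwise. Left translation by [L]
    permutes the coordinates, and no formula for the distance between two new
    points is needed. The coordinates with index [v] separate the translates of
    the extra point, which makes [L] act faithfully. *)
Lemma step_add S (h : H) (u : U) : locally_finite H ->
  exists S', [/\ extends S S', grp S' h, pts S' u &
    forall g, grp S' g -> g <> 1%g -> exists2 x, pts S' x & sact S' g x <> x].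
Proof.
move=> lf; have fS := grp_fin S.
pose L := smallest (@subgroup H) (grp S `|` [set h]).
have SL : grp S `|` [set h] `<=` L by exact: sub_smallest.
have fL : finite_subgroup L.
  split; first exact: smallest_subgroup.
  by apply: lf; rewrite finite_setU; split; [case: fS|exact: finite_set1].
pose F := pts S `|` [set u].
have finF : finite_set F.
  by rewrite finite_setU; split; [exact: pts_fin|exact: finite_set1].
pose LT : finGroupType := fsg fL; pose val_L : LT -> H := @fsg_val _ _ fL.
pose XT : finType := fset_set (pts S); pose YT : finType := fset_set F.
have XTP (x : XT) : pts S (val x).
  by have := fsvalP x; rewrite in_fset_set ?inE //; exact: pts_fin.
pose f1 (x0 : XT) (m : LT) (y : option YT) : R :=
  if y is Some y then
    if `[< grp S (val_L m) >] then mdist (sact S (val_L m)^-1%g (val x0)) (val y)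
    else 0
  else 0.
pose f2 (m : LT) (y : option YT) : R := ((y == None) && (m == 1%g))%:R.
pose f (z : LT * option YT) (i : (LT * XT) + LT) : R :=
  match i with
  | inl (v, x0) => f1 x0 (v * z.1)%g z.2
  | inr v => f2 (v * z.1)%g z.2
  end.
pose j (x : U) : LT * option YT := (1%g, insub x).
pose a (g : LT) (z : LT * option YT) := ((g * z.1)%g, z.2).
have insubF x : F x -> exists2 y : YT, insub x = Some y & val y = x.
  move=> Fx; have Fx' : x \in fset_set F by rewrite in_fset_set ?inE.
  by exists [` Fx']%fset => //; rewrite insubT.
have [||||||||||S' [e [ext gS' FS' ej [ele e0 epts eact]]]] :=
  @realize R Delta U H U_Delta dvs infD S L LT (fsg_in fL) (LT * option YT)%type
    a (supdist f) F j 1 ltr01 fL.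
- by move=> g Sg; apply: SL; left.
- by move=> x y /set_mem Lx /set_mem Ly; exact: fsg_inM.
- by case=> m y; rewrite /a mul1g.
- by move=> g k [m y]; rewrite /a mulgA.
- exact: supdist_pm.
- move=> g z z'; pose s (i : (LT * XT) + LT) : (LT * XT) + LT :=
    match i with inl (v, x0) => inl ((v * g)%g, x0) | inr v => inr (v * g)%g end.
  apply: (@supdist_reindex _ _ _ f (a g) s).
    by move=> [m y] [[v x0]|v] /=; rewrite mulgA.
  move=> [[v x0]|v]; [exists (inl ((v * g^-1)%g, x0))|exists (inr (v * g^-1)%g)];
    by rewrite /= -mulgA mulVg mulg1.
- exact: finF.
- by move=> x Sx; left.
- have half x y : pts S x -> F x -> F y -> mdist x y <= supdist f (j x) (j y).
    move=> Sx Fx Fy; have [x' xE xv] := insubF x Fx; have [y' yE yv] := insubF y Fy.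
    have Sx' : x \in fset_set (pts S) by rewrite in_fset_set ?inE //; exact: pts_fin.
    have := supdist_ge f (j x) (j y) (inl (1%g, [` Sx']%fset)).
    rewrite /= xE yE /= mulg1 /val_L fsg_val1.
    case: asboolP => [_|]; last by case; exact: fsg1.
    by rewrite invg1 sact1 // xv yv mdistxx sub0r normrN ger0_norm ?mdist_ge0.
  have symm z z' : supdist f z z' = supdist f z' z by have [_ + _] := supdist_pm f.
  move=> x y Fx Fy; apply/eqP; rewrite eq_le; apply/andP; split.
    have [x' xE xv] := insubF x Fx; have [y' yE yv] := insubF y Fy.
    apply: supdist_le => [|[[v x0]|v]]; first exact: mdist_ge0.
      rewrite /= xE yE /= mulg1 xv yv.
      by case: asboolP => _; [exact: mdist_lip|rewrite subrr normr0 mdist_ge0].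
    by rewrite /= xE yE /= /f2 /= subrr normr0 mdist_ge0.
  case: (Fx) => [Sx|xu]; first exact: half.
  case: (Fy) => [Sy|yu]; first by rewrite symm metric_sym; exact: half.
  by rewrite xu yu mdistxx supdist_ge0.
- move=> g x Sg Sx; apply: supdist_eq0.
  have Lg : L g by apply: SL; left.
  have [x' xE xv] : exists2 y : YT, insub x = Some y & val y = x.
    by apply: insubF; left.
  have [y' yE yv] : exists2 y : YT, insub (sact S g x) = Some y & val y = sact S g x.
    by apply: insubF; left; exact: sact_pts.
  case=> [[v x0]|v] /=; last by rewrite xE yE.
  rewrite xE yE /= !mulg1 /val_L fsg_valM fsg_inK // xv yv.
  case: asboolP => [Svg|nS]; case: asboolP => [Sv|nSv] //.
  + have Svi : grp S (fsg_val v)^-1%g by exact: fsgV.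
    have Sgi : grp S g^-1%g by exact: fsgV.
    have Sx0 := XTP x0.
    by rewrite invMg sactM // [LHS]sact_dist_inv //; exact: sact_pts.
  + case: nSv; rewrite -[fsg_val v]mulg1 -(mulgV g) mulgA.
    by apply: fsgM => //; exact: fsgV.
  + by case: nS; exact: fsgM.
exists S'; split=> //.
- by rewrite gS'; apply: SL; right.
- by apply: FS'; right.
move=> g; rewrite gS' => Lg g1; exists (e (1%g, None)); first exact: epts.
rewrite eact // => /e0 E; apply: g1.
have := supdist_ge f (a (fsg_in fL g) (1%g, None)) (1%g, None) (inr 1%g).
rewrite E /= /f2 !mulg1 !mul1g !eqxx /=.
case: eqP => [g1 _|_]; last by rewrite sub0r normrN normr1 ler10.
by rewrite -(fsg_inK fL Lg) g1 fsg_val1.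
Qed.

Lemma step_add_seq S (us : seq U) : locally_finite H ->
  exists S', extends S S' /\ forall u, u \in us -> pts S' u.
Proof.
move=> lf; elim: us S => [|u us IH] S; first by exists S; split=> //; exact: extends_refl.
have [S1 [e1 _ u1 _]] := step_add S 1%g u lf.
have [S2 [e2 u2]] := IH S1; exists S2; split; first exact: extends_trans e2.
move=> w; rewrite inE => /predU1P[->|/u2//].
by have [_ + _] := e2; apply.
Qed.

End AddElement.

(** * Approximate extension of partial isometries *)

Section ApproximateExtension.
Context {R : realType} {K : finGroupType} {Y : finType}.
Variables (d : Y -> Y -> R) (b : K -> Y -> Y) (P : seq (Y * Y)) (eps : R).
Hypothesis pm : pseudometric d.
Hypothesis b1 : forall y, b 1%g y = y.
Hypothesis bM : forall g h y, b (g * h)%g y = b g (b h y).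
Hypothesis b_iso : forall g x y, d (b g x) (b g y) = d x y.
Hypothesis P_iso : forall p q : Y * Y, p \in P -> q \in P -> d p.1 q.1 = d p.2 q.2.
Hypothesis P_sym : forall p : Y * Y, p \in P -> (p.2, p.1) \in P.
Hypothesis eps_gt0 : 0 < eps.

Let d_ge0 x y : 0 <= d x y. Proof. exact: pm_ge0. Qed.

Let d_sym x y : d x y = d y x. Proof. by have [_ h _] := pm. Qed.

Let D := \big[Num.max/0]_(p : Y * Y) d p.1 p.2.

Let D_ge0 : 0 <= D. Proof. exact: bigmax_ge_id. Qed.

Let d_le_D x y : d x y <= D.
Proof. exact: (@le_bigmax _ _ _ _ (fun p : Y * Y => d p.1 p.2) (x, y)). Qed.

Let b_invK g y : b g^-1%g (b g y) = y. Proof. by rewrite -bM mulVg b1. Qed.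

(** McShane extension of the function taking the value [f b + eps] at [a] for each
    pair [(a, b)] of [P], capped at [D]. *)
Definition transfer (f : Y -> R) (x : Y) : R :=
  \big[Num.min/D]_(p <- P) (f p.2 + eps + d p.1 x).

(** The word [k1 :: ... :: km] with base point [x0] stands for the product
    [k1 t k2 t ... km t] applied to [x0], where [t] is an involution freely added
    to [K]. The potential is the distance to that point when copies of [Y] are
    glued along the tree of all words, each use of [t] costing [eps]; distances
    are capped at [D]. *)
Fixpoint potential (l : seq K) (x0 : Y) : Y -> R :=
  if l is k :: l' then fun x => transfer (potential l' x0) (b k^-1%g x)
  else d x0.

Let lip (f : Y -> R) := forall x y, f x <= f y + d x y.

Lemma transfer_leD f x : transfer f x <= D.
Proof. exact: bigmin_le_id. Qed.

Lemma transfer_lip f : lip (transfer f).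
Proof.
move=> x y; have [_ _ tri] := pm.
case: (bigmin_attained P D (fun p => f p.2 + eps + d p.1 y)) =>
  [E|[p pP E]]; rewrite [in leRHS]/transfer E.
  by rewrite ler_wpDr // transfer_leD.
apply: le_trans (_ : f p.2 + eps + d p.1 x <= _); first exact: ge_bigmin_seq.
by rewrite -[leRHS]addrA lerD2l (d_sym x y) tri.
Qed.

Lemma potential_leD l x0 x : potential l x0 x <= D.
Proof. by case: l => [|k l] /=; [exact: d_le_D|exact: transfer_leD]. Qed.

Lemma potential_lip l x0 : lip (potential l x0).
Proof.
case: l => [|k l] x y /=.
  by have [_ _ tri] := pm; rewrite (d_sym x y) tri.
by rewrite -(b_iso k^-1%g); exact: transfer_lip.
Qed.

(** The potential grows by [eps] with each letter, so it is constantly [D] on long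
    words. This is why words can be cut off at a finite length. *)
Lemma potential_ge l x0 x : Num.min D (eps *+ size l) <= potential l x0 x.
Proof.
elim: l x => [|k l IH] x /=; first by rewrite ge_min d_ge0 orbT.
apply: le_bigmin => [|p _]; first by rewrite ge_min lexx.
have dpx := d_ge0 p.1 (b k^-1%g x); have := IH p.2; have := eps_gt0.
by rewrite mulrS !ge_min => e0 /orP[] h; apply/orP; [left|right]; lra.
Qed.

(** The lower bound is where the pairs in [P] need to form a partial isometry. *)
Lemma transfer_near f p : lip f -> (forall x, f x <= D) -> p \in P ->
  `|transfer f p.1 - f p.2| <= eps.
Proof.
move=> flip fD pP; have d0 : d p.1 p.1 = 0 by have [h _ _] := pm.
have up : transfer f p.1 <= f p.2 + eps.
  have := ge_bigmin_seq D p xpredT (fun q => f q.2 + eps + d q.1 p.1) pP isT.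
  by rewrite d0 addr0.
have low : f p.2 <= transfer f p.1.
  rewrite /transfer big_seq; apply: le_bigmin => // q qP.
  have := flip p.2 q.2; rewrite d_sym -P_iso //; have := eps_gt0; lra.
have := eps_gt0; rewrite ler_norml => e0; apply/andP; split; lra.
Qed.

(** The head is exempt because it is the letter on which [K] acts; elsewhere a
    trivial letter would leave two adjacent occurrences of [t]. *)
Definition reduced (l : seq K) := all (fun k => k != 1%g) (behead l).

Definition word_act (k : K) (w : seq K * Y) : seq K * Y :=
  if w.1 is k0 :: l then ((k * k0)%g :: l, w.2) else ([::], b k w.2).

Definition word_pot (w : seq K * Y) (x : Y) : R :=
  if reduced w.1 then potential w.1 w.2 x else D.

Lemma word_pot_lip w x y : `|word_pot w x - word_pot w y| <= d x y.
Proof.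
rewrite /word_pot; case: ifP => _; last by rewrite subrr normr0.
have := potential_lip w.1 w.2 x y; have := potential_lip w.1 w.2 y x.
by rewrite (d_sym y x) ler_norml => h1 h2; apply/andP; split; lra.
Qed.

Lemma word_pot_act k w x : word_pot (word_act k w) x = word_pot w (b k^-1%g x).
Proof.
case: w => [[|k0 l] y]; rewrite /word_pot /word_act /=.
  by rewrite -(b_iso k^-1%g) b_invK.
by rewrite /reduced /=; case: ifP => // _; rewrite invMg bM.
Qed.

Lemma word_actM k k' w : word_act (k * k')%g w = word_act k (word_act k' w).
Proof. by case: w => [[|k0 l] y]; rewrite /word_act /= ?bM ?mulgA. Qed.

Lemma word_act_id w : word_act 1%g w = w.
Proof. by case: w => [[|k0 l] y]; rewrite /word_act /= ?b1 ?mul1g. Qed.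

Lemma word_act_size k w : size (word_act k w).1 = size w.1.
Proof. by case: w => [[|k0 l] y]. Qed.

Let n_exists : exists n, D <= eps *+ n.
Proof.
exists (Num.bound (D / eps)); rewrite -mulr_natl -ler_pdivrMr //.
by apply/ltW/archi_boundP; rewrite divr_ge0 // ltW.
Qed.

Let n := sval (cid n_exists).

Let n_large : D <= eps *+ n. Proof. exact: (svalP (cid n_exists)). Qed.

(** Left multiplication by the involution [t]. A word that would become too long is
    fixed, which keeps the map involutive; an involution is what makes this
    truncation harmless. *)
Definition flip_head (l : seq K) : seq K :=
  if ~~ reduced l then l else
  if l is k :: l' then
    if k == 1%g then l' else if (size l < n)%N then 1%g :: l else l
  else if (size l < n)%N then 1%g :: l else l.

Definition word_flip (w : seq K * Y) : seq K * Y := (flip_head w.1, w.2).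

Lemma flip_head_size l : (size l <= n)%N -> (size (flip_head l) <= n)%N.
Proof.
rewrite /flip_head; case: ifP => // _; case: l => [|k l] /=.
  by case: ifP.
by case: ifP => _ lt; [exact: ltnW|case: ifP].
Qed.

Lemma flip_headK l : (size l <= n)%N -> flip_head (flip_head l) = l.
Proof.
rewrite {2}/flip_head; case: ifP => [|/negbFE].
  by rewrite /flip_head => ->.
case: l => [|k l] /= red szl.
  case: ifP => /= n0; first by rewrite /flip_head /= eqxx.
  by rewrite /flip_head /= n0.
case: eqP => [k1|/eqP k1].
  rewrite /flip_head; case: l red szl => [|k' l] /=.
    by move=> _ n0; rewrite n0 k1.
  rewrite /reduced /= => /andP[k'1 redl] szl.
  by rewrite redl /= (negbTE k'1) szl k1.
case: ifP => szl'.
  have red' : reduced [:: 1%g, k & l] by rewrite /reduced /= k1; exact: red.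
  by rewrite /flip_head red' /= eqxx.
by rewrite /flip_head red /= (negbTE k1) szl'.
Qed.

(** Where [word_flip] acts as multiplication by [t] this is [transfer_near], read in
    one direction or the other; where a word is fixed because of its length the
    potential is constant by [potential_ge]. *)
Lemma word_flip_near w p : (size w.1 <= n)%N -> p \in P ->
  `|word_pot (word_flip w) p.1 - word_pot w p.2| <= eps.
Proof.
have e0 := eps_gt0.
have refl (x : R) : `|x - x| <= eps by rewrite subrr normr0 ltW.
case: w => l x0 /= szl pP; rewrite /word_pot /word_flip /= /flip_head.
have [red|nred] := boolP (reduced l); last by rewrite /= (negbTE nred).
have grow : reduced (1%g :: l) -> `|(if reduced (1%g :: l) then
    potential (1%g :: l) x0 p.1 else D) - potential l x0 p.2| <= eps.
  move=> -> /=; rewrite invg1 b1; apply: transfer_near => //.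
    exact: potential_lip.
  exact: potential_leD.
have full : size l = n -> `|potential l x0 p.1 - potential l x0 p.2| <= eps.
  move=> szn; suff E x : potential l x0 x = D by rewrite !E refl.
  apply/eqP; rewrite eq_le potential_leD; apply: le_trans (potential_ge _ _ _).
  by rewrite szn le_min lexx n_large.
case: l red szl grow full => [|k l] red szl grow full /=.
  case: (ltnP 0 n) => n0; first exact: (grow isT).
  by apply: full; apply/eqP; rewrite eqn_leq n0.
case: eqP => [k1|/eqP k1]; last first.
  case: (ltnP (size l).+1 n) => lt; first by apply: grow; rewrite /reduced /= k1.
  by rewrite red; apply: full; apply/eqP; rewrite eqn_leq szl.
have redl : reduced l by move: red; rewrite /reduced /=; case: (l) => //= ? ? /andP[].
rewrite redl distrC k1 invg1 b1.
have := @transfer_near (potential l x0) (p.2, p.1) (@potential_lip l x0)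
  (potential_leD l x0) (P_sym pP).
exact.
Qed.

Let W := (n.-bseq K * Y)%type.

Let raw (w : W) : seq K * Y := (bseqval w.1, w.2).

Let lift (f : seq K * Y -> seq K * Y) (w : W) : W :=
  (insub_bseq n (f (raw w)).1, (f (raw w)).2).

Let raw_size w : (size (raw w).1 <= n)%N. Proof. exact: size_bseq. Qed.

Let rawK f w : (size (f (raw w)).1 <= n)%N -> raw (lift f w) = f (raw w).
Proof.
move=> sz; rewrite /raw /lift /= /insub_bseq.
rewrite (_ : bseqval _ = (f (raw w)).1) -?surjective_pairing //.
by rewrite -[LHS]/(val _) insubdK.
Qed.

Let raw_inj : injective raw.
Proof. by move=> [l x] [l' x'] [/val_inj -> ->]. Qed.

Let act_inj k : injective (lift (word_act k^-1%g)).
Proof.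
move=> w w' /(congr1 (fun w => word_act k (raw w))).
rewrite !rawK ?word_act_size // -!word_actM mulgV !word_act_id.
exact: raw_inj.
Qed.

Let flip_inj : injective (lift word_flip).
Proof.
move=> w w' /(congr1 (fun w => word_flip (raw w))).
rewrite !rawK ?flip_head_size ?raw_size // /word_flip /= !flip_headK ?raw_size //.
exact: raw_inj.
Qed.

(** Extending a partial isometry of a finite metric space exactly, to an isometry of
    a finite space, is a hard theorem; up to [eps] it reduces to the residual
    finiteness of a free product. Here [gT] is the group of permutations of the
    words of bounded length: [K] acts on the first letter, [t] adds or removes a
    letter of reduced words. The point [y] of the copy of [Y] indexed by [g] has as
    coordinates the potentials at [y] of all words translated by [g]. *)
Lemma approximate_extension : exists (gT : finGroupType) (iota : K -> gT)
    (t : gT) (rho : gT * Y -> gT * Y -> R),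
  [/\ {morph iota : x y / (x * y)%g}, pseudometric rho,
    forall g z z', rho ((g * z.1)%g, z.2) ((g * z'.1)%g, z'.2) = rho z z',
    forall x y, rho (1%g, x) (1%g, y) = d x y &
    (forall k x, rho (iota k, x) (1%g, b k x) = 0) /\
    (forall p, p \in P -> rho (t, p.1) (1%g, p.2) <= eps)].
Proof.
pose f (z : {perm W} * Y) (w : W) := word_pot (raw (z.1 w)) z.2.
exists {perm W}, (fun k => perm (@act_inj k)), (perm flip_inj), (supdist f).
split.
- move=> k k'; apply/permP => w; rewrite permM !permE; apply: raw_inj.
  by rewrite !rawK ?word_act_size // invMg word_actM.
- exact: supdist_pm.
- move=> g z z'.
  apply: (@supdist_reindex _ _ _ f (fun z => ((g * z.1)%g, z.2)) g).
    by move=> z0 w; rewrite /f /= permM.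
  by move=> w; exists (g^-1%g w); rewrite permKV.
- move=> x y; apply/eqP; rewrite eq_le; apply/andP; split.
    by apply: supdist_le => // w; exact: word_pot_lip.
  (* The empty word with base point x has the distance to x as its potential. *)
  have := supdist_ge f (1%g, x) (1%g, y) ([bseq], x).
  rewrite /f /= !perm1 /word_pot /=; have [h _ _] := pm.
  by rewrite h sub0r normrN ger0_norm.
- split=> [k x|p pP].
    apply: supdist_eq0 => w; rewrite /f /= permE perm1 rawK ?word_act_size //.
    by rewrite word_pot_act invgK.
  apply: supdist_le => [|w]; first exact: ltW.
  rewrite /f /= permE perm1 rawK ?flip_head_size ?raw_size //.
  exact: word_flip_near.
Qed.

End ApproximateExtension.

(** * Approximating isometries *)

Section Doubling.
Context {R : realType} {Y : finType} {d : Y -> Y -> R}.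
Hypothesis pm : pseudometric d.

(** Two copies of [Y] far apart. An isometry from a part of [Y] to another gives an
    involution between the two copies, as [approximate_extension] requires; the
    exchange of the copies is added to the group to come back. *)
Definition double_dist (z z' : Y * 'I_2) : R :=
  if z.2 == z'.2 then d z.1 z'.1
  else \big[Num.max/0]_(p : Y * Y) d p.1 p.2.

Lemma double_dist_pm : pseudometric double_dist.
Proof.
have [h1 h2 h3] := pm; rewrite /double_dist.
set D := \big[Num.max/0]_p _.
have D0 : 0 <= D by exact: bigmax_ge_id.
have dD x y : d x y <= D.
  exact: (@le_bigmax _ _ _ _ (fun p : Y * Y => d p.1 p.2) (x, y)).
split=> /=; first by move=> z; rewrite eqxx.
  by move=> z z'; rewrite eq_sym h2.
case=> [y1 c1] [y0 c0] [y2 c2] /=.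
have d0 x y : 0 <= d x y by exact: pm_ge0.
have [<-|cc] := eqVneq c0 c2.
  by have [_|_] := eqVneq c0 c1; [exact: h3|rewrite ler_wpDr].
have [<-|_] := eqVneq c0 c1; first by rewrite (negbTE cc) ler_wpDl.
by rewrite ler_wpDr //; case: ifP.
Qed.

End Doubling.

Section StepMatch.
Context {R : realType} {Delta : set R} {U : metricType R} {H : groupType}.
Hypothesis U_Delta : delta_urysohn Delta U.
Hypothesis dvs : distance_value_set Delta.
Hypothesis infD : inf Delta = 0.
Implicit Types S : stage (U := U) (H := H).

Hypothesis omni : omnigenous H.

(** The involution [t] takes the first copy of [p.1] near the second copy of [p.2],
    and [s] exchanges the copies, so [s * t] takes [p.1] near [p.2]. *)
Lemma step_match S (l : seq (U * U)) (eps : R) : 0 < eps ->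
  (forall p, p \in l -> pts S p.1 /\ pts S p.2) ->
  (forall p q, p \in l -> q \in l -> mdist p.1 q.1 = mdist p.2 q.2) ->
  exists S', extends S S' /\ exists2 h, grp S' h &
    forall p, p \in l -> mdist (sact S' h p.1) p.2 <= eps.
Proof.
move=> eps0 lS liso.
pose z1 : 'I_2 := ord_max.
have z1N : (1%g : 'I_2) == z1 = false by [].
pose K2 : finGroupType := (grpT S * 'I_2)%type.
pose Y2 : finType := (ptsT S * 'I_2)%type.
pose b (k : K2) (y : Y2) : Y2 := (actT k.1 y.1, (k.2 * y.2)%g).
pose lift (c : 'I_2) x : Y2 := (ptsT_in S x, c).
pose P : seq (Y2 * Y2) := [seq (lift 1%g p.1, lift z1 p.2) | p <- l] ++
  [seq (lift z1 p.2, lift 1%g p.1) | p <- l].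
have PP p : p \in P -> exists2 q, q \in l &
    p = (lift 1%g q.1, lift z1 q.2) \/ p = (lift z1 q.2, lift 1%g q.1).
  by rewrite mem_cat => /orP[] /mapP[q ql ->]; exists q => //; [left|right].
have dist_in x y : pts S x -> pts S y -> distT (ptsT_in S x) (ptsT_in S y) = mdist x y.
  by move=> Sx Sy; rewrite /distT !ptsT_inK.
have [|||||||gT [iota [t [rho [iotaM rpm rinv r1 [requi rt]]]]]] :=
  @approximate_extension R K2 Y2 (double_dist (d := distT (S := S))) b P (eps / 2).
- exact/double_dist_pm/distT_pm.
- by move=> [y c]; rewrite /b actT1 mul1g.
- by move=> g h [y c]; rewrite /b actTM mulgA.
- move=> g [x c] [y c']; rewrite /double_dist /b /= (inj_eq (mulgI _)).
  by rewrite actT_iso.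
- move=> p q /PP[p' pl pE] /PP[q' ql qE].
  have [p1 p2] := lS _ pl; have [q1 q2] := lS _ ql.
  case: pE => ->; case: qE => ->; rewrite /double_dist /= ?z1N ?[z1 == _]eq_sym ?z1N //.
    by rewrite ?eqxx !dist_in // liso.
  by rewrite ?eqxx !dist_in // liso.
- move=> p /PP[q ql [->|->]] /=; rewrite mem_cat; apply/orP; [right|left];
  by apply/mapP; exists q.
- exact: divr_gt0.
pose rho' (z z' : gT * ptsT S) := rho (z.1, (z.2, 1%g)) (z'.1, (z'.2, 1%g)).
have [h1 h2 h3] := rpm.
have [||||||S' [Psi [ext PsiM Psi_onto dle]]] :=
  @omnigenous_extension R Delta U H U_Delta dvs infD omni S gT
    (fun k => iota (k, 1%g)) rho' (eps / 2).
- exact: divr_gt0.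
- by move=> x y; rewrite -iotaM /mulg /=; congr (iota (_, _)); rewrite mulg1.
- by split=> *; rewrite /rho'.
- by move=> g z z'; exact: (rinv g (z.1, (z.2, 1%g)) (z'.1, (z'.2, 1%g))).
- by move=> x y; rewrite /rho' r1 /double_dist eqxx.
- move=> k x; rewrite /rho' /=.
  by have := requi (k, 1%g) (x, 1%g); rewrite /b /= mulg1.
exists S'; split=> //.
pose s := iota (1%g, z1^-1%g).
have [h Sh hE] := Psi_onto (s * t)%g.
exists h => // p pl; have [p1 p2] := lS _ pl.
apply: le_trans (dle _ _ _ Sh p1 p2) _; rewrite hE /rho' /=.
have st := rinv s (t, lift 1%g p.1) (1%g, lift z1 p.2).
have sb := requi (1%g, z1^-1%g) (lift z1 p.2).
have lt : rho (t, lift 1%g p.1) (1%g, lift z1 p.2) <= eps / 2.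
  by apply: (rt (lift 1%g p.1, lift z1 p.2)); rewrite mem_cat map_f.
move: st sb; rewrite /= mulg1 /b /= actT1 mulVg => st sb.
have := h3 (s, lift z1 p.2) ((s * t)%g, lift 1%g p.1) (1%g, lift 1%g p.2).
by rewrite st sb /lift /=; lra.
Qed.

End StepMatch.

(** * Concentration of measure in finite powers *)

Section Spread.
Context {R : realType}.

(** Up to the factor [2 * #|T| ^ 2], the variance of [f] under uniform measure. *)
Definition spread {T : finType} (f : T -> R) : R :=
  \sum_x \sum_y (f x - f y) ^+ 2.

Lemma spreadE {T : finType} (f : T -> R) :
  spread f = 2 * #|T|%:R * (\sum_x f x ^+ 2) - 2 * (\sum_x f x) ^+ 2.
Proof.
set Q := \sum_x f x ^+ 2; set S := \sum_x f x; set N := #|T|%:R.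
have inner x : \sum_y (f x - f y) ^+ 2 = N * f x ^+ 2 + (- (2 * S)) * f x + Q.
  transitivity (\sum_y (f x ^+ 2 + (- (2 * f x)) * f y + f y ^+ 2)).
    by apply: eq_bigr => y _; ring.
  by rewrite !big_split /= sumr_const -mulr_sumr -mulr_natl -/S -/Q; ring.
rewrite /spread (eq_bigr _ (fun x _ => inner x)) !big_split /= -!mulr_sumr.
by rewrite sumr_const -mulr_natl -/S -/Q -/N; ring.
Qed.

(** The law of total variance. *)
Lemma spread_prod {T T' : finType} (f : T * T' -> R) :
  spread f = #|T|%:R * (\sum_t spread (fun w => f (t, w))) +
             spread (fun t => \sum_w f (t, w)).
Proof.
rewrite !spreadE (eq_bigr _ (fun t _ => spreadE (fun w => f (t, w)))).
rewrite card_prod natrM sumrB -!mulr_sumr.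
have -> : \sum_x f x ^+ 2 = \sum_t \sum_w f (t, w) ^+ 2.
  by rewrite (pair_bigA _ (fun t w => f (t, w) ^+ 2)); apply: eq_bigr => -[].
have -> : \sum_x f x = \sum_t \sum_w f (t, w).
  by rewrite (pair_bigA _ (fun t w => f (t, w))); apply: eq_bigr => -[].
by ring.
Qed.

Lemma spread_le {T : finType} (f : T -> R) (c : R) :
  (forall x y, `|f x - f y| <= c) -> spread f <= c ^+ 2 * #|T|%:R ^+ 2.
Proof.
move=> fc.
have le x y : (f x - f y) ^+ 2 <= c ^+ 2.
  rewrite -[leLHS]real_normK ?num_real // lerXn2r ?nnegrE ?normr_ge0 //.
  exact: le_trans (fc x y).
apply: le_trans (_ : \sum_(x : T) \sum_(y : T) c ^+ 2 <= _).
  by apply: ler_sum => x _; apply: ler_sum => y _; exact: le.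
by rewrite !sumr_const -mulrnA -[leLHS]mulr_natr natrM -expr2.
Qed.

End Spread.

Section Hamming.
Context {R : realType} {K : finGroupType}.

(** The [n.+1]-fold power, defined by recursion so that [spread_prod] applies at
    each step. *)
Fixpoint power (n : nat) : finGroupType :=
  if n is n'.+1 then (K * power n')%type : finGroupType else K.

Fixpoint diag (n : nat) (k : K) : power n :=
  match n return power n with
  | 0 => k
  | n'.+1 => (k, diag n' k)
  end.

Lemma diagM n : {morph diag n : x y / (x * y)%g}.
Proof. by elim: n => //= n IH x y; rewrite IH. Qed.

Fixpoint hamming (n : nat) : power n -> power n -> R :=
  match n return power n -> power n -> R with
  | 0 => fun g h => (g != h)%:R
  | n'.+1 => fun g h => (g.1 != h.1)%:R + hamming g.2 h.2
  end.

Lemma neq_pm : pseudometric (fun g h : K => (g != h)%:R : R).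
Proof.
split=> [g|g h|h g k]; first by rewrite eqxx.
  by rewrite eq_sym.
rewrite -natrD ler_nat; have [<-|gh] := eqVneq g h; first by rewrite add0n.
by case: (g != k).
Qed.

Lemma hamming_pm n : pseudometric (@hamming n).
Proof.
elim: n => [|n [h1 h2 h3]] /=; first exact: neq_pm.
have [k1 k2 k3] := neq_pm.
split=> [g|g h|h g k]; first by rewrite eqxx h1 addr0.
  by rewrite h2 k2.
by rewrite addrACA lerD // k3.
Qed.

Lemma hamming_mulr n (g h k : power n) :
  hamming (g * k)%g (h * k)%g = hamming g h.
Proof.
elim: n g h k => [|n IH] g h k /=; first by rewrite (inj_eq (mulIg k)).
by rewrite IH (inj_eq (mulIg k.1)).
Qed.

(** Independent coordinates each contribute a bounded amount, so the variance grows
    linearly while the distances grow with the number of coordinates. *)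
Lemma spread_lipschitz n (f : power n -> R) :
  (forall x y, f x <= f y + hamming x y) ->
  spread f <= n.+1%:R * #|power n|%:R ^+ 2.
Proof.
elim: n f => [|n IH] f lip.
  apply: le_trans (_ : 1 ^+ 2 * #|K|%:R ^+ 2 <= _); last by rewrite expr1n.
  apply: spread_le => x y.
  have := lip x y; have := lip y x; have [_ h _] := @hamming_pm 0.
  rewrite (h y x) /= ler_norml.
  by case: (x != y) => /= a b; apply/andP; split; lra.
rewrite [power _]/= in f lip *.
rewrite spread_prod card_prod natrM.
have [h1 h2 h3] := @hamming_pm n; have [k1 k2 k3] := neq_pm.
have IHt t : spread (fun w => f (t, w)) <= n.+1%:R * #|power n|%:R ^+ 2.
  by apply: IH => x y; have := lip (t, x) (t, y); rewrite /= k1 add0r.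
have cross : spread (fun t => \sum_w f (t, w)) <=
    #|power n|%:R ^+ 2 * #|K|%:R ^+ 2.
  apply: spread_le.
  have half t t' : \sum_w f (t, w) <= \sum_w f (t', w) + #|power n|%:R.
    rewrite -[X in _ + X%:R]sum1_card natr_sum -big_split /=.
    apply: ler_sum => w _; apply: le_trans (lip _ (t', w)) _ => /=.
    by rewrite h1 addr0 lerD2l; case: (t != t').
  move=> t t'; have := half t t'; have := half t' t.
  by rewrite ler_norml => a b; apply/andP; split; lra.
have inner := ler_wpM2l (ler0n R #|K|) (ler_sum _ (fun t _ => IHt t)).
apply: le_trans (lerD (inner _ _) cross) _.
rewrite sumr_const -mulr_natl [n.+2%:R]mulrSr.
by rewrite le_eqVlt; apply/orP; left; apply/eqP; ring.
Qed.

(** The fibers of an onto homomorphism have the same cardinality. *)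
Lemma sum_onto (gT hT : finGroupType) (p : gT -> hT) (F : hT -> R) :
  {morph p : x y / (x * y)%g} -> (forall c, exists g, p g = c) ->
  \sum_g F (p g) * #|hT|%:R = #|gT|%:R * \sum_c F c.
Proof.
move=> pM onto.
pose m := #|[pred g | p g == 1%g]|.
have fib c : #|[pred g | p g == c]| = m.
  have [g0 g0c] := onto c.
  rewrite /m -(card_imset (mem [pred g | p g == 1%g]) (mulgI g0)).
  apply: eq_card => g; rewrite [LHS]inE.
  apply/eqP/imsetP => [gc|[k]].
    exists (g0^-1 * g)%g; last by rewrite mulgA mulgV mul1g.
    rewrite inE; apply/eqP/(mulgI (p g0)); rewrite -pM mulgA mulgV mul1g.
    by rewrite mulg1 g0c.
  by rewrite inE => /eqP pk ->; rewrite pM pk mulg1 g0c.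
have part (G : hT -> R) : \sum_g G (p g) = m%:R * \sum_c G c.
  rewrite (partition_big p xpredT) //= mulr_sumr; apply: eq_bigr => c _.
  rewrite (eq_bigr (fun=> G c)); last by move=> g /eqP ->.
  rewrite (eq_bigl (mem [pred g | p g == c])) // sumr_const.
  by rewrite fib mulr_natl.
have -> : #|gT|%:R = m%:R * #|hT|%:R :> R.
  by have := part (fun=> 1); rewrite !sumr_const.
by rewrite -mulr_suml part; ring.
Qed.

(** The distance to [A], capped at [k], is a Lipschitz function that vanishes on
    [A] and equals [k] on [B]; its variance bounds the product of the measures. *)
Lemma concentration (n : nat) (gT : finGroupType) (p : gT -> power n)
    (A B : {set gT}) (k : R) :
  {morph p : x y / (x * y)%g} -> (forall c, exists g, p g = c) -> 0 <= k ->
  (forall a b, a \in A -> b \in B -> k <= hamming (p b) (p a)) ->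
  #|A|%:R * #|B|%:R * k ^+ 2 <= n.+1%:R * #|gT|%:R ^+ 2.
Proof.
move=> pM onto k0 far.
have [h1 h2 h3] := @hamming_pm n.
have ham0 x y : 0 <= hamming x y := pm_ge0 (hamming_pm n) x y.
pose f x := \big[Num.min/k]_(a in A) hamming x (p a).
have lip x y : f x <= f y + hamming x y.
  rewrite addrC -lerBlDl; apply: le_bigmin => [|a aA].
    by rewrite lerBlDr ler_wpDr // bigmin_le_id.
  rewrite lerBlDr; apply: le_trans (bigmin_le_cond _ _ aA) _.
  by rewrite addrC h3.
have fA a : a \in A -> f (p a) = 0.
  move=> aA; apply/eqP; rewrite eq_le; apply/andP; split.
    by apply: le_trans (bigmin_le_cond _ _ aA) _; rewrite h1.
  by apply: le_bigmin => // *.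
have fB b : b \in B -> k <= f (p b).
  by move=> bB; apply: le_bigmin => // a aA; exact: far.
have scale : spread (fun g => f (p g)) * #|power n|%:R ^+ 2 =
    #|gT|%:R ^+ 2 * spread f.
  rewrite !spreadE.
  have e1 := @sum_onto gT (power n) p f pM onto.
  have e2 := @sum_onto gT (power n) p (fun x => f x ^+ 2) pM onto.
  rewrite -!mulr_suml in e1 e2.
  rewrite mulrBl -[2 * _ ^+ 2 * _]mulrA -exprMn e1.
  rewrite (_ : 2 * #|gT|%:R * (\sum_x f (p x) ^+ 2) * #|power n|%:R ^+ 2 =
    2 * #|gT|%:R * #|power n|%:R * ((\sum_x f (p x) ^+ 2) * #|power n|%:R)).
    by rewrite e2; ring.
  by ring.
have N0 : 0 < #|power n|%:R :> R.
  by rewrite ltr0n; apply/card_gt0P; exists 1%g.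
have sp : spread (fun g => f (p g)) <= n.+1%:R * #|gT|%:R ^+ 2.
  rewrite -(ler_pM2r (exprn_gt0 2 N0)) scale [leLHS]mulrC [leRHS]mulrAC.
  by rewrite ler_wpM2r ?exprn_ge0 ?ler0n // spread_lipschitz.
apply: le_trans sp; rewrite /spread.
apply: le_trans (_ : \sum_(x in A) \sum_(y in B) k ^+ 2 <= _).
  by rewrite !sumr_const -mulrnA -[leRHS]mulr_natl natrM [#|B|%:R * _]mulrC.
rewrite [leRHS](bigID (mem A)) /= ler_wpDr //.
  by apply: sumr_ge0 => x _; apply: sumr_ge0 => y _; exact: sqr_ge0.
apply: ler_sum => x xA; rewrite [leRHS](bigID (mem B)) /= ler_wpDr //.
  by apply: sumr_ge0 => y _; exact: sqr_ge0.
apply: ler_sum => y yB; rewrite fA // sub0r sqrrN.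
have kf := fB y yB; have f0 := le_trans k0 kf.
by apply: lerXn2r; rewrite ?nnegrE.
Qed.

End Hamming.

(** * Concentrating the group of a stage *)

Section PowerAction.
Context {R : realType} {K : finGroupType} {Y : finType}.
Variables (d : Y -> Y -> R) (b : K -> Y -> Y).
Hypothesis pm : pseudometric d.
Hypothesis b1 : forall y, b 1%g y = y.
Hypothesis bM : forall g h y, b (g * h)%g y = b g (b h y).
Hypothesis b_iso : forall g x y, d (b g x) (b g y) = d x y.

(** The points of [power n * Y] are seen as elements of the [n.+1]-fold power of
    [Y], with the sum of the coordinate distances. *)
Fixpoint sum_dist (n : nat) : power (K := K) n -> Y -> power (K := K) n -> Y -> R :=
  match n return power n -> Y -> power n -> Y -> R with
  | 0 => fun g x h y => d (b g x) (b h y)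
  | n'.+1 => fun g x h y => d (b g.1 x) (b h.1 y) + sum_dist g.2 x h.2 y
  end.

Lemma sum_dist_pm n :
  pseudometric (fun z z' : power n * Y => sum_dist z.1 z.2 z'.1 z'.2).
Proof.
have [d1 d2 d3] := pm; elim: n => [|n [h1 h2 h3]] /=.
  by split=> *; [exact: d1|exact: d2|exact: d3].
split=> [[[g g'] x]|[[g g'] x] [[h h'] y]|[[h h'] y] [[g g'] x] [[k k'] z]] /=.
- by rewrite d1 (h1 (g', x)) addr0.
- by rewrite d2 (h2 (g', x) (h', y)).
- by rewrite addrACA lerD ?d3 // (h3 (h', y) (g', x) (k', z)).
Qed.

Lemma sum_dist_mull n (k g h : power n) x y :
  sum_dist (k * g)%g x (k * h)%g y = sum_dist g x h y.
Proof.
elim: n k g h => [|n IH] k g h /=; first by rewrite !bM b_iso.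
by rewrite IH !bM b_iso.
Qed.

Lemma sum_dist1 n x y : sum_dist (1%g : power n) x 1%g y = n.+1%:R * d x y.
Proof.
elim: n => [|n IH] /=; first by rewrite !b1 mul1r.
by rewrite IH !b1 [n.+2%:R]mulrS mulrDl mul1r.
Qed.

Lemma sum_dist_diag n k x : sum_dist (diag n k) x 1%g (b k x) = 0.
Proof.
have [d1 _ _] := pm.
by elim: n => [|n IH] /=; rewrite b1 d1 // IH addr0.
Qed.

Lemma sum_dist_hamming n (D : R) (g h : power n) x :
  0 <= D -> (forall x y, d x y <= D) -> sum_dist g x h x <= D * hamming g h.
Proof.
move=> D0 dD; have [d1 _ _] := pm.
have one (k l : K) : d (b k x) (b l x) <= D * (k != l)%:R.
  by have [->|_] := eqVneq k l; rewrite ?d1 ?mulr0 // mulr1.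
by elim: n g h => [|n IH] g h //=; rewrite mulrDr lerD.
Qed.

End PowerAction.

(** Turns classical sets of elements of a finite subgroup into finite sets, on which
    counting is available. *)
Lemma normalized_countingE {R : realType} (G : groupType) (K A : set G)
    (hK : finite_subgroup K) :
  normalized_counting R K A =
  #|[set g : fsg hK | `[< A (fsg_val g) >]]%SET|%:R / #|{: fsg hK}|%:R.
Proof.
have card (B : set G) :
    #|` fset_set (B `&` K)| = #|[set g : fsg hK | `[< B (fsg_val g) >]]%SET|.
  rewrite cardE -(size_map (@fsg_val _ _ hK)); apply/perm_size/uniq_perm.
  - exact: fset_uniq.
  - rewrite map_inj_uniq ?enum_uniq //; exact: fsg_val_inj.
  - move=> x; rewrite in_fset_set; last by apply: finite_setIr; case: hK.
    apply/idP/mapP => [/set_mem [Bx Kx]|[g]].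
      exists (fsg_in hK x); last by rewrite fsg_inK.
      by rewrite mem_enum inE fsg_inK //; exact/asboolP.
    rewrite mem_enum [g \in _]inE => /asboolP Bg ->.
    by apply/mem_set; split=> //; exact: fsg_valP.
rewrite /normalized_counting card; congr (_ / _%:R).
rewrite -[K in fset_set K]setTI card -cardsT; congr #|pred_of_set _|.
by apply/setP => g; rewrite !inE; exact/asboolP.
Qed.

Section StepConcentrate.
Context {R : realType} {Delta : set R} {U : metricType R} {H : groupType}.
Hypothesis U_Delta : delta_urysohn Delta U.
Hypothesis dvs : distance_value_set Delta.
Hypothesis infD : inf Delta = 0.
Hypothesis omni : omnigenous H.
Implicit Types S : stage (U := U) (H := H).

(** The strong Levy condition for one subgroup and one neighborhood, the latter
    given by the points [X] and the tolerance [delta], which is used as the bound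
    on the measures as well. *)
Definition concentrated (X : set U) S (delta : R) :=
  forall A : set H, A `<=` grp S ->
  delta <= normalized_counting R (grp S) A ->
  1 - delta <= normalized_counting R (grp S)
    [set g | grp S g /\ exists2 a, A a &
       forall x, X x -> mdist (sact S (g * a^-1)%g x) x < delta].

(** The group is mapped diagonally into a large power of itself, and the stage
    diagonally into the same power of the space with the averaged distance. Group
    elements that differ in few coordinates then move all points of the diagonal
    to nearby places simultaneously, so [concentration] for the Hamming distance
    yields concentration for the action. Omnigenicity brings the large power back
    inside [H]. *)
Lemma step_concentrate S (delta : R) : 0 < delta ->
  exists S', extends S S' /\ concentrated (pts S) S' delta.
Proof.
move=> delta0; pose Y := ptsT S; pose d := distT (S := S); pose b := actT (S := S).
have pm : pseudometric d := distT_pm S.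
have b1 : forall y, b 1%g y = y := @actT1 _ _ _ S.
have bM : forall g h y, b (g * h)%g y = b g (b h y) := @actTM _ _ _ S.
have b_iso : forall g x y, d (b g x) (b g y) = d x y := @actT_iso _ _ _ S.
pose D := \big[Num.max/0]_(p : Y * Y) d p.1 p.2.
have D0 : 0 <= D by exact: bigmax_ge_id.
have dD x y : d x y <= D.
  exact: (@le_bigmax _ _ _ _ (fun p : Y * Y => d p.1 p.2) (x, y)).
(* Elements at Hamming distance less than c times the number of coordinates
   move old points to within delta / 2 of each other, before rounding. *)
pose c := delta / 2 / (D + 1).
have c0 : 0 < c by rewrite !divr_gt0 // ltr_wpDl.
have [n nlarge] : exists n, 1 / (delta ^+ 2 * c ^+ 2) <= n.+1%:R.
  exists (Num.bound (1 / (delta ^+ 2 * c ^+ 2))).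
  rewrite mulrS ler_wpDl //; apply/ltW/archi_boundP.
  by rewrite divr_ge0 // mulr_ge0 // sqr_ge0.
have n0 : 0 < n.+1%:R :> R by rewrite ltr0n.
pose rho (z z' : power (K := grpT S) n * Y) :=
  sum_dist d b z.1 z.2 z'.1 z'.2 / n.+1%:R.
have [h1 h2 h3] := sum_dist_pm b pm n.
have [||||||S' [Psi [ext PsiM Psi_onto dle]]] :=
  @omnigenous_extension R Delta U H U_Delta dvs infD omni S
    (power (K := grpT S) n) (diag n) rho (delta / 2).
- exact: divr_gt0.
- exact: diagM.
- split=> [z|z z'|z' z z'']; rewrite /rho; first by rewrite h1 mul0r.
    by rewrite (h2 z z').
  by rewrite -mulrDl ler_pM2r ?invr_gt0 // (h3 z' z z'').
- by move=> g z z'; rewrite /rho /= sum_dist_mull.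
- by move=> x y; rewrite /rho sum_dist1 // mulrAC divff ?mul1r // gt_eqF.
- by move=> k x; rewrite /rho sum_dist_diag // mul0r.
exists S'; split=> // A AS' muA.
have fS' := grp_fin S'.
pose G : finGroupType := fsg fS'; pose p (g : G) := Psi (@fsg_val _ _ fS' g).
have pM : {morph p : x y / (x * y)%g}.
  by move=> x y; rewrite /p fsg_valM PsiM // inE; exact: fsg_valP.
have p_onto e : exists g, p g = e.
  have [g S'g <-] := Psi_onto e.
  by exists (fsg_in fS' g); rewrite /p fsg_inK.
have p1 : p 1%g = 1%g.
  by apply: mulg_idem; rewrite -pM mulg1.
have pV g : p g^-1%g = (p g)^-1%g.
  by apply: (mulgI (p g)); rewrite -pM !mulgV.
set good := [set g | _ /\ _].
rewrite !(normalized_countingE _ fS') in muA *.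
set A' : {set G} := finset _ in muA.
set good' : {set G} := finset _.
pose B : {set G} := ~: good'.
pose k := n.+1%:R * c.
have far x y : x \in A' -> y \in B -> k <= hamming (p y) (p x).
  rewrite !inE => Ax /asboolP nB; rewrite leNgt; apply/negP => lt.
  apply: nB; split; first exact: fsg_valP.
  exists (fsg_val x) => // u Su.
  have S'yx : grp S' (fsg_val y * (fsg_val x)^-1)%g.
    by apply: fsgM; [| |apply: fsgV] => //; exact: fsg_valP.
  apply: le_lt_trans (dle _ u u S'yx Su Su) _.
  suff : rho (Psi (fsg_val y * (fsg_val x)^-1)%g, ptsT_in S u) (1%g, ptsT_in S u)
    < delta / 2 by lra.
  have -> : Psi (fsg_val y * (fsg_val x)^-1)%g = (p y * (p x)^-1)%g.
    by rewrite -pV -pM /p fsg_valM fsg_valV.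
  rewrite /rho ltr_pdivrMr //=.
  have := sum_dist_hamming b pm (p y * (p x)^-1)%g 1%g (ptsT_in S u) D0 dD.
  move=> /le_lt_trans; apply.
  rewrite -[1%g](mulgV (p x)) hamming_mulr.
  apply: le_lt_trans (_ : (D + 1) * hamming (p y) (p x) < _).
    rewrite ler_wpM2r ?lerDl //.
    by rewrite (pm_ge0 (hamming_pm n)).
  have D1 : 0 < D + 1 by rewrite ltr_wpDl.
  by rewrite -ltr_pdivlMl // [ltRHS](_ : _ = k) // /k /c; field; rewrite gt_eqF.
have k0 : 0 < k by rewrite mulr_gt0.
have := concentration pM p_onto (ltW k0) far.
set N : R := #|G|%:R => conc.
have N0 : 0 < N by rewrite ltr0n; apply/card_gt0P; exists 1%g.
have cardB : #|B|%:R = N - #|good'|%:R :> R.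
  by rewrite /N -(cardsC good') natrD addrAC subrr add0r.
rewrite -/N in muA *; rewrite ler_pdivlMr // in muA.
set x : R := #|A'|%:R in muA conc; set y : R := #|B|%:R in cardB conc.
have y0 : 0 <= y by exact: ler0n.
(* With x, y and N the cardinals of A', B and G, s3 is the expected bound on y. *)
have s1 : 1 <= n.+1%:R * (delta ^+ 2 * c ^+ 2).
  by rewrite -ler_pdivrMr // mulr_gt0 // exprn_gt0.
have s2 : delta * y * n.+1%:R * c ^+ 2 <= N.
  rewrite -(ler_pM2r (mulr_gt0 N0 n0)).
  have -> : N * (N * n.+1%:R) = n.+1%:R * N ^+ 2 by ring.
  apply: le_trans conc.
  have -> : delta * y * n.+1%:R * c ^+ 2 * (N * n.+1%:R) =
    (delta * N) * (y * k ^+ 2) by rewrite /k; ring.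
  by rewrite -[leRHS]mulrA ler_wpM2r // mulr_ge0 // sqr_ge0.
have s3 : y <= delta * N.
  rewrite -[leLHS]mulr1; apply: le_trans (ler_wpM2l y0 s1) _.
  have -> : y * (n.+1%:R * (delta ^+ 2 * c ^+ 2)) =
    delta * (delta * y * n.+1%:R * c ^+ 2) by ring.
  by rewrite ler_pM2l.
by rewrite ler_pdivlMr // mulrBl mul1r; lra.
Qed.

End StepConcentrate.

(** * The topology of pointwise convergence *)

Section InitialTopology.
Context {S : choiceType} {T : topologicalType} (f : S -> T).

Lemma cvg_initial (F : set_system S) (s : S) : Filter F ->
  f @ F --> f s -> F --> (s : initial_topology f).
Proof.
move=> FF fF A /= [_ [[B oB <-] Bs BA]].
apply: filterS BA _; apply: fF; exact: open_nbhs_nbhs.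
Qed.

End InitialTopology.

Section IsoTopology.
Context {R : realType} {U : metricType R}.

Lemma iso_eval_continuous (u : U) : continuous (fun f : iso U => f u).
Proof.
move=> g; have c := @initial_continuous _ _ (@iso_ptws R U) g.
have := @pointwise_cvgP U U (@iso_ptws R U @ nbhs g) (iso_ptws g) _.
move=> [/(_ c) + _]; exact.
Qed.

Lemma cvg_iso (F : set_system (iso U)) (g : iso U) : Filter F ->
  (forall u, (fun f : iso U => f u) @ F --> g u) -> F --> g.
Proof.
move=> FF cvF; apply: (@cvg_initial _ _ (@iso_ptws R U)).
by apply/pointwise_cvgP => u; exact: cvF.
Qed.

(** The sets containing a basic neighborhood form a filter; it converges to [g]
    because it does so pointwise, hence it refines the neighborhoods of [g]. *)
Lemma iso_nbhs_basis (g : iso U) (A : set (iso U)) : nbhs g A ->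
  exists (us : seq U) (e : R), 0 < e /\
    forall f : iso U, (forall u, u \in us -> mdist (g u) (f u) < e) -> A f.
Proof.
pose F : set_system (iso U) := fun A => exists (us : seq U) (e : R), 0 < e /\
    forall f : iso U, (forall u, u \in us -> mdist (g u) (f u) < e) -> A f.
have FF : Filter F.
  split.
  - by exists [::], 1; split.
  - move=> P Q [us [e [e0 hP]]] [vs [e' [e'0 hQ]]].
    exists (us ++ vs), (Num.min e e'); split; first by rewrite lt_min e0.
    move=> f hf; split; [apply: hP|apply: hQ] => u uu;
      (have := hf u; rewrite mem_cat uu ?orbT lt_min => /(_ isT)/andP[]//).
  - by move=> P Q PQ [us [e [e0 hP]]]; exists us, e; split=> // f /hP /PQ.
have : F --> g; last exact.
apply: cvg_iso => u; apply/metricType_numDomainType.cvgrPdist_lt => e e0.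
by exists [:: u], e; split=> // f; apply; rewrite mem_head.
Qed.

Context {H : groupType} (pi : H -> iso U).
Hypothesis piM : {morph pi : x y / (x * y)%g}.
Hypothesis pi_inj : injective pi.
Local Notation G := (initial_topology pi).

Lemma morph_iso1 u : pi 1%g u = u.
Proof.
have /(congr1 (fun f : iso U => f u)) /= := piM 1%g 1%g.
by rewrite mulg1 => /iso_inj <-.
Qed.

Lemma morph_isoV x u : pi x (pi x^-1%g u) = u.
Proof.
by rewrite -[LHS]/((pi x * pi x^-1)%g u) -piM mulgV morph_iso1.
Qed.

Lemma eval_continuous u : continuous (fun x : G => pi x u).
Proof.
move=> x; apply: (@continuous_comp _ _ _ (pi : G -> iso U) (fun f : iso U => f u)).
  exact: initial_continuous.
exact: iso_eval_continuous.
Qed.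

Lemma cvg_eval (F : set_system G) (x : G) : Filter F ->
  (forall u, (fun y => pi y u) @ F --> pi x u) -> F --> x.
Proof.
by move=> FF cvF; apply: cvg_initial; apply: cvg_iso => u; exact: cvF.
Qed.

Lemma eval_near (x : G) u e : 0 < e ->
  \forall y \near x, mdist (pi x u) (pi (y : H) u) < e.
Proof.
move=> e0; have /metricType_numDomainType.cvgrPdist_lt := @eval_continuous u x.
exact.
Qed.

Lemma initial_topological_group : topological_group G.
Proof.
split.
- move=> x y clxy; apply: pi_inj; apply: iso_ext => u.
  apply: (@metric_hausdorff R U) => A B nA nB.
  have [z [Az Bz]] := clxy _ _ (@eval_continuous u x _ nA) (@eval_continuous u y _ nB).
  by exists (pi z u).
- move=> -[a b]; apply: cvg_eval => u; apply/metricType_numDomainType.cvgrPdist_lt => e e0.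
  have e2 : 0 < e / 2 by rewrite divr_gt0.
  exists ([set x : G | mdist (pi a (pi b u)) (pi (x : H) (pi b u)) < e / 2],
          [set y : G | mdist (pi b u) (pi (y : H) u) < e / 2]).
    by split; exact: eval_near.
  move=> [x y] [/= xa yb]; rewrite !piM /=.
  apply: le_lt_trans (metric_triangle _ (pi x (pi b u)) _) _.
  by rewrite iso_isometric [e]splitr ltrD.
- move=> a; have FF := @fmap_filter _ _ (fun x : G => (x^-1)%g) _ (nbhs_filter a).
  apply: cvg_eval => u; apply/metricType_numDomainType.cvgrPdist_lt => e e0.
  have near_a : \forall x \near a, mdist (pi a^-1%g u) (pi (x : H)^-1%g u) < e.
    apply: filterS (@eval_near a (pi a^-1%g u) e e0) => x.
    rewrite morph_isoV -{1}(morph_isoV x u) iso_isometric.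
    by rewrite metric_sym.
  exact: near_a.
Qed.

Lemma dense_range : (forall (g : iso U) (us : seq U) (e : R), 0 < e ->
    exists h, forall u, u \in us -> mdist (g u) (pi h u) < e) ->
  dense (range pi).
Proof.
move=> approx O [g Og] oO.
have [us [e [e0 hO]]] := iso_nbhs_basis (open_nbhs_nbhs (conj oO Og)).
have [h hh] := approx g us e e0.
by exists (pi h); split; [exact: hO|exists h].
Qed.

Lemma open_initial_basis (V : set G) : open V -> V 1%g ->
  exists (us : seq U) (e : R), 0 < e /\
    forall h : H, (forall u, u \in us -> mdist u (pi h u) < e) -> V h.
Proof.
move=> [B oB <-] B1.
have [us [e [e0 hB]]] := iso_nbhs_basis (open_nbhs_nbhs (conj oB B1)).
exists us, e; split=> // h hh; apply: hB => u uus.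
by rewrite morph_iso1; exact: hh.
Qed.

End IsoTopology.

Section Liminf.
Context {R : realType}.

(** For a bounded sequence [limn_inf] is the supremum of the infima of its tails, so
    one of these infima is positive. *)
Lemma limn_inf_gt0 (u : R^nat) : (forall n, 0 <= u n <= 1) ->
  0 < limn_inf u -> exists2 c, 0 < c & \forall n \near \oo, c <= u n.
Proof.
move=> u01; rewrite limn_infE; last first.
  exists 1; split=> // x x1 n _ /=; have /andP[u0 u1] := u01 n.
  by rewrite ger0_norm // (le_trans u1) // ltW.
move=> /sup_gt [|_ [n _ <-] c0]; first by exists (infs u 0%N); exists 0%N.
exists (infs u n) => //; exists n => // m /= nm.
apply: ge_inf; last by exists m.
by exists 0 => _ [k _ <-]; have /andP[] := u01 k.
Qed.

End Liminf.

(** * The limit of a chain of stages *)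

Section Limit.
Context {R : realType} {U : metricType R} {H : groupType}.
Variable St : nat -> stage (U := U) (H := H).
Hypothesis St_succ : forall n, extends (St n) (St n.+1).
Hypothesis exhaust_H : forall h, exists n, grp (St n) h.
Hypothesis exhaust_U : forall u, exists n, pts (St n) u.

Lemma chain_extends m n : (m <= n)%N -> extends (St m) (St n).
Proof.
move=> /subnK <-; elim: (n - m)%N => [|k IH]; first exact: extends_refl.
exact: extends_trans IH (St_succ _).
Qed.

Lemma chain_grp m n h : (m <= n)%N -> grp (St m) h -> grp (St n) h.
Proof. by move=> /chain_extends[+ _ _]; apply. Qed.

Lemma chain_pts m n u : (m <= n)%N -> pts (St m) u -> pts (St n) u.
Proof. by move=> /chain_extends[_ + _]; apply. Qed.

Lemma exhaust h u : exists n, grp (St n) h /\ pts (St n) u.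
Proof.
have [m hm] := exhaust_H h; have [n un] := exhaust_U u.
exists (maxn m n); split.
  exact: chain_grp (leq_maxl m n) hm.
exact: chain_pts (leq_maxr m n) un.
Qed.

Lemma exhaust_seq (us : seq U) : exists n, forall u, u \in us -> pts (St n) u.
Proof.
elim: us => [|u us [n hn]]; first by exists 0%N.
have [m hm] := exhaust_U u; exists (maxn m n) => v; rewrite inE.
move=> /predU1P[->|/hn]; first exact: chain_pts (leq_maxl m n) hm.
exact/chain_pts/leq_maxr.
Qed.

(** Any stage containing [h] and [u] would give the same value, by
    [limit_actE]. *)
Definition limit_act (h : H) (u : U) : U := sact (St (sval (cid (exhaust h u)))) h u.

Lemma limit_actE n h u : grp (St n) h -> pts (St n) u ->
  limit_act h u = sact (St n) h u.
Proof.
rewrite /limit_act; case: cid => m /= [mh mu] nh nu.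
have [_ _ am] := chain_extends (leq_maxl m n).
have [_ _ an] := chain_extends (leq_maxr m n).
by rewrite -am // an.
Qed.

Lemma limit_act1 u : limit_act 1%g u = u.
Proof.
have [n un] := exhaust_U u.
by rewrite (@limit_actE n) ?sact1 //; exact/fsg1/grp_fin.
Qed.

Lemma limit_actM g h u : limit_act (g * h)%g u = limit_act g (limit_act h u).
Proof.
have [m [gm um]] := exhaust g u; have [k hk] := exhaust_H h.
pose n := maxn m k.
have gn : grp (St n) g by exact: chain_grp (leq_maxl m k) gm.
have un : pts (St n) u by exact: chain_pts (leq_maxl m k) um.
have hn : grp (St n) h by exact: chain_grp (leq_maxr m k) hk.
rewrite (@limit_actE n h) // (@limit_actE n (g * h)%g) //; last first.
  by apply: fsgM => //; exact: grp_fin.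
by rewrite (@limit_actE n) ?sactM //; exact: sact_pts.
Qed.

Lemma limit_isometric h : isometric (limit_act h).
Proof.
move=> x y; have [m [hm xm]] := exhaust h x; have [k yk] := exhaust_U y.
pose n := maxn m k.
have hn : grp (St n) h by exact: chain_grp (leq_maxl m k) hm.
have xn : pts (St n) x by exact: chain_pts (leq_maxl m k) xm.
have yn : pts (St n) y by exact: chain_pts (leq_maxr m k) yk.
by rewrite !(@limit_actE n) // sact_iso.
Qed.

Lemma limit_surj h y : exists x, limit_act h x = y.
Proof.
by exists (limit_act h^-1%g y); rewrite -limit_actM mulgV limit_act1.
Qed.

Definition limit_iso (h : H) : iso U := Iso (@limit_isometric h) (@limit_surj h).

Lemma limit_isoM : {morph limit_iso : x y / (x * y)%g}.
Proof. by move=> x y; apply: iso_ext => u; exact: limit_actM. Qed.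

Lemma limit_iso_inj :
  (forall n g, grp (St n) g -> g <> 1%g ->
     exists2 x, pts (St n.+1) x & sact (St n.+1) g x <> x) ->
  injective limit_iso.
Proof.
move=> faithful g h gh.
suff E : (g * h^-1)%g = 1%g by rewrite -[g]mulg1 -(mulVg h) mulgA E mul1g.
apply: contrapT => /[dup] ne; have [n nG] := exhaust_H (g * h^-1)%g.
move=> /(faithful _ _ nG)[x xn]; apply.
rewrite -(@limit_actE n.+1) //; last exact: chain_grp nG.
rewrite limit_actM -[limit_act g]/(limit_iso g : U -> U) gh.
by rewrite -[LHS]/(limit_act h _) -limit_actM mulgV limit_act1.
Qed.

(** Any positive lower bound on measures and any basic neighborhood are eventually
    covered by the tolerance and the points of the stages. The shift of index
    comes from concentration being relative to the points of the previous stage. *)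
Lemma concentrated_levy :
  (forall n, concentrated (pts (St n)) (St n.+1) (n.+1%:R^-1)) ->
  injective limit_iso -> strong_levy R (initial_topology limit_iso).
Proof.
move=> conc inj; split; first exact: (initial_topological_group limit_isoM inj).
pose K n : set (initial_topology limit_iso) := grp (St n.+1).
have finK n : finite_subgroup (K n) by exact: grp_fin.
have nc01 n A : 0 <= normalized_counting R (K n) A <= 1.
  rewrite (normalized_countingE _ (grp_fin (St n.+1))) divr_ge0 ?ler0n //=.
  rewrite ler_pdivrMr ?mul1r ?ler_nat ?max_card // ltr0n.
  by apply/card_gt0P; exists 1%g.
exists K; split=> //.
- by move=> i j ij; have [+ _ _] := chain_extends (m := i.+1) (n := j.+1) ij.
- move=> O [h Oh] _; have [n hn] := exhaust_H h.
  exists h; split=> //; exists n => //.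
  exact: chain_grp (leqnSn n) hn.
move=> V A oV V1 AK /(limn_inf_gt0 (fun n => nc01 n (A n))) [c c0 cA].
have [us [e [e0 hV]]] := open_initial_basis limit_isoM oV V1.
have [N hN] := exhaust_seq us.
apply/cvgrPdist_le => /= eps eps0.
have small (x : R) : 0 < x -> \forall n \near \oo, n.+1%:R^-1 <= x.
  move=> x0; have /cvgrPdist_le /(_ x x0) := @cvg_harmonic R.
  by apply: filterS => n; rewrite sub0r normrN ger0_norm // /harmonic /= invr_ge0 ler0n.
have FN : Filter (nbhs (\oo : set_system nat)) by exact: filter_filter.
have large := filterI (filterI (small eps eps0) (small c c0))
  (filterI (small e e0) (filterI cA (nbhs_infty_ge N))).
apply: filterS (large _ _ _ _) => n [[le_eps le_c] [le_e [cAn le_N]]].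
have /andP[lo hi] := nc01 n [set (v * a)%g | v in V & a in A n].
rewrite ler_norml; apply/andP; split; first by rewrite lerBrDr; lra.
suff : 1 - n.+1%:R^-1 <= normalized_counting R (K n) [set (v * a)%g | v in V & a in A n].
  move=> le2; apply: le_trans le_eps; rewrite lerBlDr addrC -lerBlDr; exact: le2.
have := conc n (A n) (AK n).
have -> : n.+1%:R^-1 <= normalized_counting R (grp (St n.+1)) (A n).
  exact: le_trans le_c cAn.
move=> /(_ isT) /le_trans; apply.
rewrite !(normalized_countingE _ (grp_fin (St n.+1))) ler_wpM2r ?invr_ge0 ?ler0n //.
rewrite ler_nat; apply/subset_leq_card/fintype.subsetP => g.
rewrite !inE => -[Kg [a Aa da]].
have Sa : grp (St n.+1) a := AK n a Aa.
exists (fsg_val g * a^-1)%g; last by exists a => //; rewrite -mulgA mulVg mulg1.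
apply: hV => u uus.
have un : pts (St n) u.
  exact: chain_pts (hN u uus).
rewrite metric_sym -[limit_iso _ u]/(limit_act _ u) (@limit_actE n.+1).
- exact: lt_le_trans (da u un) le_e.
- by apply: fsgM => //; [exact: grp_fin|apply: fsgV => //; exact: grp_fin].
- exact: chain_pts un.
Qed.

End Limit.

Lemma countable_enumeration (T : choiceType) (x0 : T) : countable [set: T] ->
  exists e : nat -> T, forall x, exists n, e n = x.
Proof.
move=> /countable_injP[f finj].
exists (fun n => xget x0 [set x | f x = n]) => x; exists (f x).
case: xgetP => [y _ /= fy|/(_ x)]; last by case.
by apply: finj; rewrite ?inE.
Qed.

Section Construction.
Context {R : realType} {Delta : set R} {U : metricType R} {H : groupType}.
Hypothesis U_Delta : delta_urysohn Delta U.
Hypothesis dvs : distance_value_set Delta.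
Hypothesis infD : inf Delta = 0.
Hypothesis omni : omnigenous H.
Hypothesis lf : locally_finite H.
Implicit Types S : stage (U := U) (H := H).

Lemma urysohn_point : exists u : U, True.
Proof.
have [||||e _] := @urysohn_extension R Delta U U_Delta unit (fun _ _ => 0) set0
  (fun _ => tt).
- by split=> // *; rewrite addr0.
- by move=> z z'; rewrite eqxx.
- exact: finite_set0.
- by [].
by exists (e tt).
Qed.

Lemma trivial_stage : exists S : stage (U := U) (H := H), True.
Proof.
have [u _] := urysohn_point.
have fin1 : finite_subgroup [set 1%g : H].
  split; last exact: finite_set1.
  split; first by rewrite inE.
  by move=> x y; rewrite !inE => -> ->; rewrite invg1 mulg1.
unshelve eexists (@Stage R U H [set 1%g] [set u] (fun _ x => x) fin1 _ _ _ _ _ _).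
- exact: finite_set1.
- by exists u.
all: by [].
Qed.

Lemma concentrated_sub (X X' : set U) S (delta : R) : X `<=` X' ->
  concentrated X' S delta -> concentrated X S delta.
Proof.
move=> XX' conc A AS muA; apply: le_trans (conc A AS muA) _.
rewrite !(normalized_countingE _ (grp_fin S)) ler_wpM2r ?invr_ge0 ?ler0n //.
rewrite ler_nat; apply/subset_leq_card/fintype.subsetP => g.
rewrite !inE => -[Kg [a Aa da]]; split=> //; exists a => // x /XX'; exact: da.
Qed.

(** One step of the construction: it absorbs [h] and the points in [l], makes the
    old group act faithfully, approximates the partial isometry listed in [l], and
    concentrates. *)
Definition next_stage (h : H) (l : seq (U * U)) (eps delta : R) S S' :=
  [/\ extends S S', grp S' h,
      forall g, grp S g -> g <> 1%g ->
        exists2 x, pts S' x & sact S' g x <> x,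
      (forall p, p \in l -> pts S' p.1) /\
      ((forall p q, p \in l -> q \in l -> mdist p.1 q.1 = mdist p.2 q.2) ->
        exists2 k, grp S' k &
          forall p, p \in l -> mdist (sact S' k p.1) p.2 <= eps) &
      concentrated (pts S) S' delta].

(** Concentration comes last because it does not survive an enlargement of the
    group, unlike the other requirements. *)
Lemma next_stage_exists h l eps delta S : 0 < eps -> 0 < delta ->
  exists S', next_stage h l eps delta S S'.
Proof.
move=> eps0 delta0; have [u _] := urysohn_point.
have [S1 [e1 h1 _ f1]] := step_add U_Delta dvs infD S h u lf.
have [S2 [e2 l2]] :=
  step_add_seq U_Delta dvs infD S1 (map fst l ++ map snd l) lf.
have lS2 p : p \in l -> pts S2 p.1 /\ pts S2 p.2.
  by move=> pl; split; apply: l2; rewrite mem_cat map_f ?orbT.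
have [S3 [e3 m3]] : exists S3, extends S2 S3 /\
    ((forall p q, p \in l -> q \in l -> mdist p.1 q.1 = mdist p.2 q.2) ->
    exists2 k, grp S3 k & forall p, p \in l -> mdist (sact S3 k p.1) p.2 <= eps).
  have [liso|nliso] :=
    pselect (forall p q, p \in l -> q \in l -> mdist p.1 q.1 = mdist p.2 q.2).
    have [S3 [e3 m3]] := step_match U_Delta dvs infD omni eps0 lS2 liso.
    by exists S3.
  by exists S2; split; [exact: extends_refl|].
have [S4 [e4 c4]] := step_concentrate U_Delta dvs infD omni S3 delta0.
have e14 : extends S1 S4.
  by apply: extends_trans e4; apply: extends_trans e3.
have e03 : extends S S3.
  by apply: extends_trans e3; apply: extends_trans e2.
exists S4; split.
- exact: extends_trans e14.
- by have [+ _ _] := e14; apply.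
- move=> g Sg g1; have [g01 _ _] := e1; have [_ p14 a14] := e14.
  have [x x1 gx] := f1 g (g01 _ Sg) g1.
  by exists x; [exact: p14|rewrite a14 //; exact: g01].
- have [g34 p34 a34] := e4; have [_ p23 _] := e3.
  split=> [p /lS2[p1 _]|/m3[k k3 hk]]; first exact/p34/p23.
  exists k; first exact: g34.
  by move=> p pl; rewrite a34 ?hk //; apply: p23; have [] := lS2 _ pl.
- by apply: concentrated_sub c4; have [] := e03.
Qed.

End Construction.

Theorem theorem7p8 (R : realType) (Delta : set R) (U : metricType R)
    (H : groupType)
    (countable_Delta : countable Delta)
    (dvs_Delta : distance_value_set Delta)
    (inf_Delta : inf Delta = 0)
    (U_Delta : delta_urysohn Delta U)
    (countable_H : countable [set: H])
    (omnigenous_H : omnigenous H)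
    (locally_finite_H : locally_finite H) :
  exists pi : H -> iso U,
    [/\ {morph pi : x y / (x * y)%g},
        injective pi,
        dense (range pi) &
        strong_levy R (initial_topology pi)].
Proof.
have [u0 _] := urysohn_point U_Delta.
have [S0 _] := trivial_stage (H := H) U_Delta.
have [countable_U _ _ _] := U_Delta.
have [eH eH_onto] := countable_enumeration 1%g countable_H.
have [eU /choice[iU iUK]] := countable_enumeration u0 countable_U.
pose task (n : nat) : seq (nat * nat) * nat := odflt ([::], 0%N) (choice.unpickle n).
have taskK l m : task (choice.pickle (l, m)) = (l, m) by rewrite /task choice.pickleK.
(* Each finite list of pairs of points comes with each precision at some step;
   a list with the single pair (u, u) is what adds u. *)
pose pairs n := [seq (eU p.1, eU p.2) | p <- (task n).1].
have [T hT] := choice (fun x : nat * stage =>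
  next_stage_exists (Delta := Delta) U_Delta dvs_Delta inf_Delta omnigenous_H
    locally_finite_H (eH x.1) (pairs x.1)
    (eps := (task x.1).2.+1%:R^-1) (delta := x.1.+1%:R^-1) x.2
    (ltac:(by rewrite invr_gt0 ltr0n)) (ltac:(by rewrite invr_gt0 ltr0n))).
pose St := fix St n := if n is m.+1 then T (m, St m) else S0.
have hSt n : next_stage (eH n) (pairs n) (task n).2.+1%:R^-1 n.+1%:R^-1
    (St n) (St n.+1) := hT (n, St n).
have St_succ n : extends (St n) (St n.+1) by have [] := hSt n.
have exhaust_H h : exists n, grp (St n) h.
  by have [n <-] := eH_onto h; exists n.+1; have [] := hSt n.
have exhaust_U u : exists n, pts (St n) u.
  pose n := choice.pickle ([:: (iU u, iU u)], 0%N); exists n.+1.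
  have [_ _ _ [+ _] _] := hSt n; move=> /(_ (u, u)); apply.
  by rewrite /pairs taskK /= iUK mem_head.
pose pi := limit_iso St_succ exhaust_H exhaust_U.
have pi_inj : injective pi.
  by apply: limit_iso_inj => n g; have [_ _ + _ _] := hSt n; apply.
exists pi; split=> //.
- exact: limit_isoM.
- apply: dense_range => g us e e0.
  pose l := [seq (iU u, iU (g u)) | u <- us].
  have [m me] : exists m, m.+1%:R^-1 < e.
    exists (Num.bound e^-1); rewrite invf_plt ?posrE ?ltr0n //.
    apply: lt_trans (archi_boundP _) _; first by rewrite invr_ge0 ltW.
    by rewrite ltr_nat.
  pose n := choice.pickle (l, m).
  have pairsE : pairs n = [seq (u, g u) | u <- us].
    by rewrite /pairs taskK -map_comp; apply: eq_map => u /=; rewrite !iUK.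
  have [_ _ _ [pn match_n] _] := hSt n; rewrite pairsE taskK /= in pn match_n.
  have [|k Sk hk] := match_n.
    by move=> _ _ /mapP[u _ ->] /mapP[v _ ->] /=; rewrite iso_isometric.
  exists k => u uus; have pu : (u, g u) \in [seq (u, g u) | u <- us].
    by apply/mapP; exists u.
  have pik : pi k u = sact (St n.+1) k u.
    exact: limit_actE Sk (pn _ pu).
  rewrite metric_sym pik.
  exact: le_lt_trans (hk _ pu) me.
- by apply: concentrated_levy => // n; have [] := hSt n.
Qed.
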